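(* Let $S\subset\mathbb{R}^n$ be a semialgebraic set. There is a Noetherian topology on $S$ whose closed sets are precisely the semialgebraic subsets of $S$ that are arc-symmetric in $S$.
   Context: An analytic arc $\gamma:(-1,1)\to S$ is a map with image in $S$ that is real analytic as a map into $\mathbb{R}^n$. A subset $E\subset S$ is called arc-symmetric in $S$ if for every analytic arc $\gamma:(-1,1)\to S$, $\gamma((-1,0))\subset E$ implies $\gamma((-1,1))\subset E$; equivalently, for every analytic arc $\gamma:(-1,1)\to S$, if $\gamma^{-1}(E)$ has nonempty interior then $\gamma^{-1}(E)=(-1,1)$. A topology is Noetherian if every descending chain $F_1\supset F_2\supset\cdots$ of closed sets stabilizes. *)

(* Defs.v *)
From HB Require Import structures.
From mathcomp Require Import all_boot all_order all_algebra.
From mathcomp Require Import all_classical all_reals all_analysis.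
(* The notations of mpoly clash with those of mathcomp-analysis. *)
From mathcomp Require Import -(notations) mpoly.

Set Implicit Arguments.
Unset Strict Implicit.
Unset Printing Implicit Defensive.

Import Order.TTheory GRing.Theory Num.Theory.
Import numFieldNormedType.Exports.

Local Open Scope classical_set_scope.
Local Open Scope ring_scope.

Section Semialgebraic.
Context {R : realType} {n : nat}.

Definition poly_at (x : 'rV[R]_n) (p : mpoly n R) : R :=
  meval (fun i => x ord0 i) p.

Definition basic_semialgebraic (eqs ineqs : seq (mpoly n R)) :
    set 'rV[R]_n :=
  [set x | (forall f : mpoly n R, f \in eqs -> poly_at x f = 0) /\
           (forall g : mpoly n R, g \in ineqs -> 0 < poly_at x g)].

Definition semialgebraic (A : set 'rV[R]_n) : Prop :=
  exists s : seq (seq (mpoly n R) * seq (mpoly n R)),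
    A = [set x | exists2 b, b \in s & basic_semialgebraic b.1 b.2 x].

End Semialgebraic.

Section ArcSymmetric.
Context {R : realType} {n : nat}.

Definition real_analytic_at (f : R -> R) (a : R) : Prop :=
  exists c : nat -> R,
    \forall h \near (0 : R), pseries c h @ \oo --> f (a + h).

(* An arc is a total function of which only the values on ]-1, 1[ matter. *)
Definition analytic_arc (S : set 'rV[R]_n) (gamma : R -> 'rV[R]_n) : Prop :=
  (forall t, t \in `](-1), 1[ -> S (gamma t)) /\
  (forall t, t \in `](-1), 1[ ->
     forall i, real_analytic_at (fun u => gamma u ord0 i) t).

Definition arc_symmetric (S E : set 'rV[R]_n) : Prop :=
  forall gamma, analytic_arc S gamma ->
    (forall t, t \in `](-1), 0[ -> E (gamma t)) ->
    forall t, t \in `](-1), 1[ -> E (gamma t).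

End ArcSymmetric.

Definition noetherian_space (T : topologicalType) : Prop :=
  forall F : nat -> set T,
    (forall k, closed (F k)) -> (forall k, F k.+1 `<=` F k) ->
    exists N, forall k, (N <= k)%N -> F k = F N.

(* Main.v *)
Require Import Defs.
From HB Require Import structures.
From mathcomp Require Import all_boot all_order all_algebra.
From mathcomp Require Import all_classical all_reals all_analysis.
From mathcomp Require Import -(notations) mpoly.
From mathcomp Require ordered_qelim qe_rcf polyrcf.
From mathcomp Require Import ring lra.

(** The closed sets must be stable under finite unions and arbitrary
    intersections, and descending chains of them must stabilize.

    Finite unions. Along an analytic arc every polynomial has a constant sign just
    to the right of a point, so an arc does not oscillate between two
    semialgebraic sets ([semialgebraic_decided_right]). An arc-symmetric set that
    contains a nontrivial piece of an arc contains the whole arc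
    ([arc_symmetric_extend]).

    Chains. The descending chain condition is proved by induction on the dimension
    of the ambient affine space, for the subsets of an arbitrary semialgebraic set
    [S] ([semialgebraic_arc_noetherian]). Cut [S] into finitely many cells, each a
    graph or a band over a semialgebraic set of one variable less, such that an
    analytic arc in the shadow of a cell lifts to the cell through any prescribed
    point ([cell_decomposition]). It suffices to treat a chain [E k] in one cell.
    The points of the shadow whose whole fibre lies in [E k] form, by lifting of
    arcs, a chain of arc-symmetric sets in one variable less, hence are
    independent of [k] from some [N] on ([full_fibres_stabilize]). In a graph this
    determines [E k]. In a band, a fibre not contained in [E N] meets [E N] in a
    set without interior, because vertical segments are arcs; so the part of [E N]
    over the remaining points decomposes into graphs only, and graphs are already
    settled ([arc_noetherian_cell]).

    Cells. Cylindrical decompositions with analytic boundaries are replaced by a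
    weaker construction. The bounding functions of the cells are the simple roots,
    in the last variable, of the iterated derivatives of the polynomials that
    define [S]. A simple root continues analytically along an arc by the implicit
    function theorem for power series in one variable
    ([real_analytic_implicit]). Where the number of these roots is constant, the
    local continuations exhaust them and keep their order, so that the [j]-th root
    is analytic along arcs ([nth_fibre_analytic]). The cells are semialgebraic by
    quantifier elimination ([definable_semialgebraic]).

    Arbitrary intersections reduce to finite ones by the chain condition
    ([arc_closed_bigcap]). *)

Set Implicit Arguments.
Unset Strict Implicit.
Unset Printing Implicit Defensive.

Import Order.TTheory GRing.Theory Num.Theory.
Import numFieldNormedType.Exports.
Import ordered_qelim.ord (formula, holds).

(** * Power series in a weighted l1 norm *)
Section PowerSeries.
Local Open Scope classical_set_scope.
Local Open Scope ring_scope.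
Context {R : realType}.
Implicit Types (c d u : nat -> R) (a r A B h x y : R).

(** The bound [A] on the norm of [c] at radius [r] is stated on partial sums: the
    norm is submultiplicative for the Cauchy product, and a bound that holds for
    all truncations passes to coefficientwise limits. *)
Definition l1_bounded c r A := forall N, \sum_(k < N) `|c k| * r ^+ k <= A.

Definition cauchy_prod c d : nat -> R :=
  fun k => \sum_(i < k.+1) c i * d (k - i)%N.

Lemma pseriesE c h N : pseries c h N = \sum_(k < N) c k * h ^+ k.
Proof. by rewrite /pseries /series /= big_mkord. Qed.

Lemma l1_bounded_ge0 c r A : l1_bounded c r A -> 0 <= A.
Proof. by move=> /(_ 0); rewrite big_ord0. Qed.

Lemma l1_bounded_radius c r s A :
  0 <= s <= r -> l1_bounded c r A -> l1_bounded c s A.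
Proof.
move=> /andP[s0 sr] cA N; apply: le_trans (cA N).
apply: ler_sum => k _; apply: ler_wpM2l => //.
by apply: lerXn2r => //; rewrite nnegrE (le_trans s0).
Qed.

Lemma l1_boundedW c r A B : A <= B -> l1_bounded c r A -> l1_bounded c r B.
Proof. by move=> AB cA N; apply: le_trans AB. Qed.

Lemma l1_boundedD c d r A B : 0 <= r -> l1_bounded c r A -> l1_bounded d r B ->
  l1_bounded (fun k => c k + d k) r (A + B).
Proof.
move=> r0 cA dB N; apply: le_trans (lerD (cA N) (dB N)).
rewrite -big_split /=; apply: ler_sum => k _; rewrite -mulrDl.
by apply: ler_wpM2r; rewrite ?exprn_ge0 ?ler_normD.
Qed.

Lemma l1_boundedZ a c r A : l1_bounded c r A ->
  l1_bounded (fun k => a * c k) r (`|a| * A).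
Proof.
move=> cA N; under eq_bigr do rewrite normrM -mulrA.
by rewrite -mulr_sumr; apply: ler_wpM2l.
Qed.

(** What the product of the two truncations has in excess of this double sum are
    the terms of total degree at least [N]; the next two lemmas estimate them. *)
Lemma cauchy_prod_trunc (f g : nat -> R) N :
  \sum_(k < N) cauchy_prod f g k =
  \sum_(i < N) \sum_(j < N | (i + j < N)%N) f i * g j.
Proof.
rewrite /cauchy_prod.
transitivity (\sum_(k < N) \sum_(i < N | (i <= k)%N) f i * g (k - i)%N).
  apply: eq_bigr => k _.
  by rewrite (big_ord_widen_cond _ xpredT (fun i => f i * g (k - i)%N) (ltn_ord k)).
rewrite (exchange_big_dep xpredT) //=; apply: eq_bigr => i _.
rewrite -(big_mkord (fun k => i <= k)%N (fun k => f i * g (k - i)%N)).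
rewrite -(big_mkord (fun j => i + j < N)%N (fun j => f i * g j)).
rewrite (big_cat_nat _ (n := i)) ?(ltnW (ltn_ord i)) //=.
rewrite big_nat_cond big_pred0 ?add0r; last first.
  by move=> k; case: ltnP => //= ki; rewrite leqNgt ki.
rewrite -{1}[i : nat]add0n big_addn.
rewrite [RHS](big_cat_nat _ (n := N - i)) ?leq_subr //=.
rewrite [X in _ + X]big_nat_cond [X in _ + X]big_pred0 ?addr0; last first.
  by move=> k; rewrite leq_subLR; case: (ltnP (i + k) N) => //; rewrite andbF.
rewrite big_nat_cond [RHS]big_nat_cond; apply: congr_big => // k.
  by rewrite leq_addl ltn_subRL; case: (_ < _)%N.
by rewrite addnK.
Qed.

Lemma l1_bounded_cauchy_prod c d r A B : 0 <= r ->
  l1_bounded c r A -> l1_bounded d r B ->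
  l1_bounded (cauchy_prod c d) r (A * B).
Proof.
move=> r0 cA dB N.
have nn (e : nat -> R) i : 0 <= `|e i| * r ^+ i by rewrite mulr_ge0 ?exprn_ge0.
pose f k := `|c k| * r ^+ k; pose g k := `|d k| * r ^+ k.
apply: le_trans (_ : \sum_(k < N) cauchy_prod f g k <= _).
  apply: ler_sum => k _; rewrite /cauchy_prod.
  apply: (le_trans (ler_wpM2r _ (ler_norm_sum _ _ _))); first exact: exprn_ge0.
  rewrite mulr_suml; apply: ler_sum => i _; rewrite /f /g normrM.
  by rewrite mulrACA -exprD subnKC // -ltnS.
rewrite cauchy_prod_trunc.
apply: le_trans (_ : \sum_(i < N) \sum_(j < N) f i * g j <= _).
  apply: ler_sum => i _; rewrite [leRHS](bigID (fun j : 'I_N => (i + j < N)%N)) /=.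
  by rewrite lerDl sumr_ge0 // => j _; rewrite mulr_ge0 ?nn.
under eq_bigr do rewrite -mulr_sumr.
rewrite -mulr_suml; apply: ler_pM => //; apply: sumr_ge0 => i _; exact: nn.
Qed.

Lemma l1_bounded_cvg c r A h :
  l1_bounded c r A -> `|h| <= r -> cvgn (pseries c h).
Proof.
move=> cA hr; apply: (@normed_cvg R R).
pose v := fun N => \sum_(k < N) `|c k * h ^+ k|.
set w := (X in cvgn X); have -> : w = v.
  by apply/funext => N; rewrite /w /v /normed_series_of /= /series /= big_mkord.
apply: nondecreasing_is_cvgn.
  by apply/nondecreasing_seqP => N; rewrite /v big_ord_recr /= lerDl.
exists A => _ [N _ <-]; apply: le_trans (cA N).
rewrite /v; apply: ler_sum => k _.
by rewrite normrM ler_wpM2l // normrX lerXn2r ?nnegrE // (le_trans _ hr).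
Qed.

Definition psum c h : R := limn (pseries c h).

Lemma psumP c r A h :
  l1_bounded c r A -> `|h| <= r -> pseries c h @ \oo --> psum c h.
Proof. by move=> cA hr; apply: l1_bounded_cvg cA hr. Qed.

Lemma cvg_pseriesD c d h x y :
  pseries c h @ \oo --> x -> pseries d h @ \oo --> y ->
  pseries (fun k => c k + d k) h @ \oo --> x + y.
Proof.
move=> cx dy; rewrite (_ : pseries _ _ = fun N => pseries c h N + pseries d h N).
  exact: cvgD.
apply/funext => N; rewrite !pseriesE -big_split /=.
by apply: eq_bigr => k _; rewrite mulrDl.
Qed.

Lemma cvg_pseriesZ a c h x :
  pseries c h @ \oo --> x -> pseries (fun k => a * c k) h @ \oo --> a * x.
Proof.
move=> cx; rewrite (_ : pseries _ _ = fun N => a * pseries c h N).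
  by apply: cvgMl_tmp.
apply/funext => N; rewrite !pseriesE mulr_sumr.
by apply: eq_bigr => k _; rewrite mulrA.
Qed.

(** At radius [r / 2] each omitted term of total degree at least [N] is
    [2 ^- N] times its majorant at radius [r]. *)
Lemma cvg_pseriesM c d r A B h x y :
  l1_bounded c r A -> l1_bounded d r B -> `|h| <= r / 2 ->
  pseries c h @ \oo --> x -> pseries d h @ \oo --> y ->
  pseries (cauchy_prod c d) h @ \oo --> x * y.
Proof.
move=> cA dB hr cx dy.
have r0 : 0 <= r by have := le_trans (normr_ge0 h) hr; lra.
have key : (fun N => pseries c h N * pseries d h N - pseries (cauchy_prod c d) h N)
   @ \oo --> 0.
  apply: (@squeeze_cvgr _ _ _ _ (fun N => - (A * B * (2^-1) ^+ N))
     (fun N => A * B * (2^-1) ^+ N)).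
  - near=> N; rewrite -ler_norml.
    pose f k := c k * h ^+ k; pose g k := d k * h ^+ k.
    have -> : pseries (cauchy_prod c d) h N = \sum_(k < N) cauchy_prod f g k.
      rewrite pseriesE; apply: eq_bigr => k _; rewrite /cauchy_prod mulr_suml.
      apply: eq_bigr => i _; rewrite /f /g mulrACA -exprD subnKC //.
      by rewrite -ltnS.
    rewrite cauchy_prod_trunc !pseriesE mulr_suml -sumrB.
    apply: (le_trans (ler_norm_sum _ _ _)).
    apply: le_trans (_ : (\sum_(i < N) `|c i| * r ^+ i) *
       (\sum_(j < N) `|d j| * r ^+ j) * 2^-1 ^+ N <= _); last first.
      apply: ler_wpM2r; first by rewrite exprn_ge0.
      by apply: ler_pM => //; apply: sumr_ge0 => i _;
        rewrite mulr_ge0 ?exprn_ge0.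
    rewrite mulr_suml mulr_suml; apply: ler_sum => i _.
    rewrite mulr_sumr (bigID (fun j : 'I_N => (i + j < N)%N)) /= addrAC subrr add0r.
    apply: (le_trans (ler_norm_sum _ _ _)).
    rewrite mulr_sumr mulr_suml.
    rewrite [leRHS](bigID (fun j : 'I_N => (i + j < N)%N)) /=.
    have nn j : 0 <= `|c i| * r ^+ i * (`|d j| * r ^+ j) * 2^-1 ^+ N.
      by rewrite !mulr_ge0 ?exprn_ge0.
    rewrite -[leLHS]add0r; apply: lerD; first by apply: sumr_ge0 => j _; exact: nn.
    apply: ler_sum => j; rewrite -leqNgt => Nij.
    have -> : `|f i * g j| = `|c i| * `|d j| * `|h| ^+ (i + j).
      by rewrite /f /g !normrM !normrX exprD; ring.
    have -> : `|c i| * r ^+ i * (`|d j| * r ^+ j) * 2^-1 ^+ N =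
        `|c i| * `|d j| * (r ^+ (i + j) * 2^-1 ^+ N) by rewrite exprD; ring.
    apply: ler_wpM2l; first by rewrite mulr_ge0.
    apply: le_trans (_ : (r / 2) ^+ (i + j) <= _).
      by apply: lerXn2r; rewrite ?nnegrE // (le_trans _ hr).
    rewrite exprMn; apply: ler_wpM2l; first exact: exprn_ge0.
    by apply: ler_wiXn2l => //; lra.
  - rewrite -oppr0; apply: cvgN; rewrite -(mulr0 (A * B)); apply: cvgMl_tmp.
    by apply: cvg_expr; rewrite ger0_norm; lra.
  - rewrite -(mulr0 (A * B)); apply: cvgMl_tmp.
    by apply: cvg_expr; rewrite ger0_norm; lra.
have -> : pseries (cauchy_prod c d) h = fun N => pseries c h N * pseries d h N -
  (pseries c h N * pseries d h N - pseries (cauchy_prod c d) h N).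
  by apply/funext => N; rewrite subKr.
rewrite -[x * y]subr0; apply: cvgB => //; exact: cvgM.
Unshelve. all: by end_near.
Qed.

(** The tail of the series starts with a factor [h]. *)
Lemma psum_dist c r A h x : 0 < r -> l1_bounded c r A -> `|h| <= r ->
  pseries c h @ \oo --> x -> `|x - c 0%N| <= A * (`|h| / r).
Proof.
move=> r0 cA hr cx.

have tail N : `|pseries c h N.+1 - c 0%N| <= A * (`|h| / r).
  rewrite pseriesE big_ord_recl expr0 mulr1 addrAC subrr add0r.
  apply: (le_trans (ler_norm_sum _ _ _)).
  apply: le_trans (_ : (\sum_(k < N.+1) `|c k| * r ^+ k) * (`|h| / r) <= _); last first.
    by apply: ler_wpM2r; rewrite ?divr_ge0 // ltW.
  rewrite mulr_suml big_ord_recl; apply: ler_wpDl.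
    by rewrite !mulr_ge0 ?invr_ge0 ?exprn_ge0 // ltW.
  apply: ler_sum => k _; rewrite normrM normrX -mulrA; apply: ler_wpM2l => //=.
  rewrite /bump add1n exprS [in leRHS]exprSr mulrC -mulrA [r * _]mulrC.
  rewrite divfK ?gt_eqF //.
  by apply: ler_wpM2r => //; apply: lerXn2r; rewrite ?nnegrE // ltW.
have cn : (fun N => `|pseries c h N - c 0%N|) @ \oo --> `|x - c 0%N|.
  by apply: cvg_norm; apply: cvgB => //; exact: cvg_cst.
by apply: (cvgr_to_le cn); exists 1%N => // -[].
Qed.

(** * Germs of analytic functions of one variable *)

(** Analyticity at [a] together with a majorant, which is what products and
    compositions of power series consume. *)
Definition expands (f : R -> R) a c r A :=
  [/\ 0 < r, l1_bounded c r A &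
      forall h, `|h| <= r -> pseries c h @ \oo --> f (a + h)].

Lemma real_analytic_expands (f : R -> R) a :
  real_analytic_at f a -> exists c r A, expands f a c r A.
Proof.
move=> [c] /nbhs_ballP[e /= e0 ce]; exists c; exists (e / 4).
have ine h : `|h| < e -> pseries c h @ \oo --> f (a + h).
  by move=> he; apply: ce; rewrite /ball /= sub0r normrN.
have e20 : 0 < e / 2 by lra.
have e40 : 0 < e / 4 by lra.
have c2 : cvgn (pseries c (e / 2)).
  by apply/cvg_ex; exists (f (a + e / 2)); apply: ine; rewrite gtr0_norm //; lra.
have c4 : cvgn (pseries (fun i => `|c i|) (e / 4)).
  by apply: is_cvg_pseries_inside_norm c2 _; rewrite !gtr0_norm //; lra.
exists (psum (fun i => `|c i|) (e / 4)); split => //.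
  move=> N; rewrite -(pseriesE (fun i => `|c i|)).
  apply: nondecreasing_cvgn_le => //.
  apply/nondecreasing_seqP => n; rewrite !pseriesE big_ord_recr /= lerDl.
  by rewrite mulr_ge0 // exprn_ge0 // ltW.
by move=> h hr; apply: ine; apply: le_lt_trans hr _; lra.
Qed.

Lemma expands_real_analytic (f : R -> R) a c r A :
  expands f a c r A -> real_analytic_at f a.
Proof.
move=> [r0 _ cf]; exists c; apply/nbhs_ballP; exists r => //= h.
by rewrite /ball /= sub0r normrN => /ltW; exact: cf.
Qed.

Lemma expands_radius (f : R -> R) a c r s A :
  0 < s <= r -> expands f a c r A -> expands f a c s A.
Proof.
move=> /andP[s0 sr] [r0 cA cf]; split=> //.
  by apply: l1_bounded_radius cA; rewrite sr ltW.
by move=> h hs; apply: cf; exact: le_trans sr.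
Qed.

Lemma expandsW (f : R -> R) a c r A B :
  A <= B -> expands f a c r A -> expands f a c r B.
Proof. by move=> AB [r0 cA cf]; split=> //; exact: l1_boundedW cA. Qed.

Lemma expands0 (f : R -> R) a c r A : expands f a c r A -> f a = c 0%N.
Proof.
move=> [r0 cA /(_ 0)]; rewrite normr0 addr0 => /(_ (ltW r0)) cf.
apply/eqP; rewrite -subr_eq0 -normr_le0.
by have := psum_dist r0 cA _ cf; rewrite normr0 mul0r mulr0; apply; rewrite ltW.
Qed.

Lemma expandsM (f g : R -> R) a c d r A B :
  expands f a c r A -> expands g a d r B ->
  expands (fun t => f t * g t) a (cauchy_prod c d) (r / 2) (A * B).
Proof.
move=> [r0 cA cf] [_ dB dg]; split; first by lra.
  apply: (@l1_bounded_radius _ r); first by apply/andP; split; lra.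
  by apply: l1_bounded_cauchy_prod => //; exact: ltW.
move=> h hr; have hr' : `|h| <= r by lra.
by apply: cvg_pseriesM hr _ _; [exact: cA|exact: dB|exact: cf|exact: dg].
Qed.

Lemma expandsD (f g : R -> R) a c d r A B :
  expands f a c r A -> expands g a d r B ->
  expands (fun t => f t + g t) a (fun k => c k + d k) r (A + B).
Proof.
move=> [r0 cA cf] [_ dB dg]; split=> //; first by apply: l1_boundedD => //; exact: ltW.
by move=> h hr; apply: cvg_pseriesD; [exact: cf|exact: dg].
Qed.

Lemma real_analytic_cst (b a : R) : real_analytic_at (fun=> b) a.
Proof.
exists (fun k => if k is 0%N then b else 0); apply: filterE => h.
apply: cvg_near_cst; exists 1%N => // -[//|N] _ /=.
rewrite pseriesE big_ord_recl expr0 mulr1 big1 ?addr0 // => i _.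
by rewrite /= mul0r.
Qed.

Lemma real_analytic_id (a : R) : real_analytic_at id a.
Proof.
exists (fun k => if k is 0%N then a else if k is 1%N then 1 else 0).
apply: filterE => h; apply: cvg_near_cst; exists 2%N => // -[//|[//|N]] _ /=.
rewrite pseriesE big_ord_recl big_ord_recl big1 => [|i _]; last by rewrite /= mul0r.
by rewrite expr0 expr1 mulr1 mul1r addr0.
Qed.

Lemma real_analyticD (f g : R -> R) a :
  real_analytic_at f a -> real_analytic_at g a ->
  real_analytic_at (fun t => f t + g t) a.
Proof.
move=> /real_analytic_expands[c [r [A cf]]] /real_analytic_expands[d [s [B dg]]].
have r0 : 0 < r by case: cf.
have s0 : 0 < s by case: dg.
pose m := Num.min r s.
have m0 : 0 < m by rewrite lt_min r0.
have mr : 0 < m <= r by rewrite m0 ge_min lexx.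
have ms : 0 < m <= s by rewrite m0 ge_min lexx orbT.
exact: expands_real_analytic (expandsD (expands_radius mr cf) (expands_radius ms dg)).
Qed.

Lemma real_analyticM (f g : R -> R) a :
  real_analytic_at f a -> real_analytic_at g a ->
  real_analytic_at (fun t => f t * g t) a.
Proof.
move=> /real_analytic_expands[c [r [A cf]]] /real_analytic_expands[d [s [B dg]]].
have r0 : 0 < r by case: cf.
have s0 : 0 < s by case: dg.
pose m := Num.min r s.
have m0 : 0 < m by rewrite lt_min r0.
have mr : 0 < m <= r by rewrite m0 ge_min lexx.
have ms : 0 < m <= s by rewrite m0 ge_min lexx orbT.
exact: expands_real_analytic (expandsM (expands_radius mr cf) (expands_radius ms dg)).
Qed.

Lemma near_shift0 (a : R) (P : R -> Prop) :
  (\forall t \near a, P t) <-> (\forall h \near (0 : R), P (a + h)).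
Proof.
rewrite (near_shift 0 a) subr0 /=.
by split; apply: filterS => h; rewrite /= addrC.
Qed.

Lemma real_analytic_near_eq (f g : R -> R) a :
  (\forall t \near a, f t = g t) -> real_analytic_at f a -> real_analytic_at g a.
Proof.
move=> /near_shift0 fg [c cf]; exists c.
by apply: filterS2 fg cf => h ->.
Qed.

Lemma real_analytic_sum (I : Type) (s : seq I) (P : pred I) (F : I -> R -> R) a :
  (forall i, real_analytic_at (F i) a) ->
  real_analytic_at (fun t => \sum_(i <- s | P i) F i t) a.
Proof.
move=> Fa; elim: s => [|i s IH].
  have -> : (fun t => \sum_(i <- [::] | P i) F i t) = fun=> 0.
    by apply/funext => t; rewrite big_nil.
  exact: real_analytic_cst.
have -> : (fun t => \sum_(i <- i :: s | P i) F i t) =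
    fun t => (if P i then F i t else 0) + \sum_(i <- s | P i) F i t.
  by apply/funext => t; rewrite big_cons; case: (P i); rewrite ?add0r.
by apply: real_analyticD => //; case: (P i) => //; exact: real_analytic_cst.
Qed.

Lemma real_analyticX (f : R -> R) a k :
  real_analytic_at f a -> real_analytic_at (fun t => f t ^+ k) a.
Proof.
move=> fa; elim: k => [|k IH]; first exact: real_analytic_cst.
rewrite (_ : (fun t => _) = fun t => f t * f t ^+ k); first exact: real_analyticM.
by apply/funext => t; rewrite exprS.
Qed.

Lemma real_analytic_prod (I : Type) (s : seq I) (F : I -> R -> R) a :
  (forall i, real_analytic_at (F i) a) ->
  real_analytic_at (fun t => \prod_(i <- s) F i t) a.
Proof.
move=> Fa; elim: s => [|i s IH].
  have -> : (fun t => \prod_(i <- [::]) F i t) = fun=> 1.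
    by apply/funext => t; rewrite big_nil.
  exact: real_analytic_cst.
have -> : (fun t => \prod_(i <- i :: s) F i t) =
    fun t => F i t * \prod_(i <- s) F i t.
  by apply/funext => t; rewrite big_cons.
exact: real_analyticM.
Qed.

Lemma real_analytic_continuous (f : R -> R) a :
  real_analytic_at f a -> f t @[t --> a] --> f a.
Proof.
move=> /real_analytic_expands[c [r [A cf]]]; have [r0 cA fh] := cf.
apply/cvgrPdist_le => e e0; apply/near_shift0.
have A0 : 0 <= A := l1_bounded_ge0 cA.
have d0 : 0 < Num.min r (e * r / (A + 1)).
  by rewrite lt_min r0 divr_gt0 ?mulr_gt0 //; lra.
apply/nbhs_ballP; exists (Num.min r (e * r / (A + 1))) => //= h.
rewrite /ball /= sub0r normrN lt_min => /andP[hr he].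
rewrite distrC (expands0 cf).
apply: (le_trans (psum_dist r0 cA (ltW hr) (fh _ (ltW hr)))).
rewrite mulrA ler_pdivrMr //; apply: le_trans (_ : (A + 1) * `|h| <= _).
  by apply: ler_wpM2r => //; lra.
by rewrite mulrC -ler_pdivlMr ?ltW //; lra.
Qed.

Lemma real_analytic_affine (f : R -> R) p q a :
  real_analytic_at f (p + q * a) -> real_analytic_at (fun t => f (p + q * t)) a.
Proof.
move=> [c cf]; exists (fun k => c k * q ^+ k).
have : \forall h \near (0 : R), pseries c (q * h) @ \oo --> f (p + q * a + q * h).
  have hq : (fun h => q * h) @ (0 : R) --> (0 : R).
    by rewrite -[X in _ --> X](mulr0 q); apply: cvgMl_tmp; exact: cvg_id.
  exact: (hq _ cf).
apply: filterS => h; rewrite mulrDr addrA.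
rewrite (_ : pseries c (q * h) = pseries (fun k => c k * q ^+ k) h) //.
by apply/funext => N; rewrite !pseriesE; apply: eq_bigr => k _; rewrite exprMn mulrA.
Qed.

(** Unless all Taylor coefficients vanish, the first nonzero one gives the sign
    of the function on the right of the point. *)
Lemma real_analytic_sign (f : R -> R) a : real_analytic_at f a ->
  [\/ \forall t \near a^'+, f t = 0, \forall t \near a^'+, 0 < f t |
      \forall t \near a^'+, f t < 0].
Proof.
move=> /real_analytic_expands[c [r [A cf]]]; have [r0 cA fh] := cf.
have right (P : R -> Prop) : (\forall h \near (0 : R), 0 < h -> P (a + h)) ->
    \forall t \near a^'+, P t.
  move=> Ph; rewrite near_withinE; apply/near_shift0.
  by apply: filterS Ph => h hP; rewrite ltrDl.
have near_r : \forall h \near (0 : R), `|h| <= r.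
  apply/nbhs_ballP; exists r => //= h; rewrite /ball /= sub0r normrN; exact: ltW.
have [c0|/existsNP/= cn0] := pselect (forall k, c k = 0).
  apply: Or31; apply: right; apply: filterS near_r => h hr _.
  have := fh h hr; rewrite (_ : pseries c h = fun=> 0); last first.
    by apply/funext => N; rewrite pseriesE big1 // => i _; rewrite c0 mul0r.
  by move=> /cvg_lim <- //; rewrite lim_cst.
have ex : exists k, c k != 0 :> R by case: cn0 => k /eqP; exists k.
case: (ex_minnP ex) => k ck kmin {cn0 ex}.
pose d j := c (k + j)%N.
have dA : l1_bounded d r (A / r ^+ k).
  move=> N; rewrite ler_pdivlMr ?exprn_gt0 // mulr_suml.
  apply: le_trans (cA (k + N)%N); rewrite big_split_ord /=.
  apply: ler_wpDl; first by apply: sumr_ge0 => i _; rewrite mulr_ge0 // exprn_ge0 // ltW.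
  by apply: ler_sum => j _; rewrite /d -mulrA -exprD addnC.
have fd h : `|h| <= r -> f (a + h) = h ^+ k * psum d h.
  move=> hr; move: (fh h hr); rewrite -(cvg_shiftn k) => pc.
  have pc' : (fun N => h ^+ k * pseries d h N) @ \oo --> h ^+ k * psum d h.
    by apply: cvgMl_tmp; exact: psumP dA hr.
  have eqd : [sequence pseries c h (N + k)%N]_N = fun N => h ^+ k * pseries d h N.
    apply/funext => N; rewrite /= !pseriesE addnC big_split_ord /= big1 ?add0r => [|i _].
      by rewrite mulr_sumr; apply: eq_bigr => j _; rewrite /d exprD; ring.
    case: (eqVneq (c i) 0) => [->|/kmin]; first by rewrite mul0r.
    by rewrite leqNgt ltn_ord.
  by rewrite eqd in pc; apply: cvg_unique pc pc'.
have d0 : d 0%N != 0 by rewrite /d addn0.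
have de : expands (fun t => psum d (t - a)) a d r (A / r ^+ k).
  by split=> // h hr; rewrite addrAC subrr add0r; exact: psumP dA hr.
have dc := real_analytic_continuous (expands_real_analytic de).
rewrite -(expands0 de) in d0.
case: (ltgtP (psum d (a - a)) 0) d0 => // d0 _.
  apply: Or33; apply: right.
  have /near_shift0 : \forall t \near a, psum d (t - a) < 0 by apply: cvgr_lt dc _ d0.
  apply: filterS2 near_r => h hr; rewrite addrAC subrr add0r => dh h0.
  by rewrite fd // pmulr_rlt0 // exprn_gt0.
apply: Or32; apply: right.
have /near_shift0 : \forall t \near a, psum d (t - a) > 0 by apply: cvgr_gt dc _ d0.
apply: filterS2 near_r => h hr; rewrite addrAC subrr add0r => dh h0.
by rewrite fd // mulr_gt0 // exprn_gt0.
Qed.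
End PowerSeries.

(** * The analytic implicit function theorem in one variable *)
Section ImplicitFunction.
Local Open Scope classical_set_scope.
Local Open Scope ring_scope.
Context {R : realType}.
Implicit Types (u v c : nat -> R) (r A : R).

Definition agree_below m u v := forall k, (k < m)%N -> u k = v k.

Lemma agree_cauchy_prod m u v c (d : nat -> R) : agree_below m u v -> agree_below m c d ->
  agree_below m (cauchy_prod u c) (cauchy_prod v d).
Proof.
move=> uv cd k km; apply: eq_bigr => i _; rewrite uv ?cd //.
  by apply: leq_ltn_trans km; exact: leq_subr.
by apply: leq_ltn_trans km; rewrite -ltnS.
Qed.

(** Without constant terms, the coefficient of degree [m] of a product involves
    only coefficients of smaller degree: this is what makes the fixed point
    iteration below converge coefficientwise. *)
Lemma agree_cauchy_prod0 m u v c (d : nat -> R) :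
  u 0%N = 0 -> v 0%N = 0 -> c 0%N = 0 -> d 0%N = 0 ->
  agree_below m u v -> agree_below m c d ->
  agree_below m.+1 (cauchy_prod u c) (cauchy_prod v d).
Proof.
move=> u0 v0 c0 d0 uv cd k km; apply: eq_bigr => i _.
have [i0|i0] := eqVneq (i : nat) 0%N; first by rewrite i0 u0 v0 !mul0r.
have [ik|ik] := eqVneq (i : nat) k; first by rewrite ik subnn c0 d0 !mulr0.
have lik : (i < k)%N by rewrite ltn_neqAle ik -ltnS ltn_ord.
have i1 : (0 < i)%N by rewrite lt0n.
rewrite uv ?cd //; last exact: leq_trans lik _.
apply: leq_trans (_ : k <= m)%N => //; rewrite ltn_subrL i1 /=.
exact: leq_trans lik.
Qed.

(** Coefficients of [b_0 + u b_1 + ... + u ^ (k - 1) b_(k - 1)]. *)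
Fixpoint horner_series (b : nat -> nat -> R) k u : nat -> R :=
  if k is k'.+1 then
    fun i => b 0%N i + cauchy_prod u (horner_series (fun d => b d.+1) k' u) i
  else fun=> 0.

Lemma agree_horner_series b k m u v : agree_below m u v ->
  agree_below m (horner_series b k u) (horner_series b k v).
Proof.
move=> uv; elim: k b => [|k IH] b i im //=; congr (_ + _).
by apply: agree_cauchy_prod im => //; exact: IH.
Qed.

Lemma l1_bounded_horner_series b k u r A : 0 <= r -> 0 <= A ->
  (forall d, (d < k)%N -> l1_bounded (b d) r A) -> l1_bounded u r 1 ->
  l1_bounded (horner_series b k u) r (A * k%:R).
Proof.
move=> r0 A0; elim: k b => [|k IH] b bA u1 /=.
  by move=> N; rewrite mulr0 big1 // => i _; rewrite normr0 mul0r.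
rewrite -natr1 mulrDr mulr1 addrC; apply: l1_boundedD => //; first exact: bA.
rewrite -[A * _]mul1r; apply: l1_bounded_cauchy_prod => //.
by apply: IH => // d dk; exact: bA.
Qed.

Lemma cvg_horner_series (b : nat -> nat -> R) k u r A h (x : R) (y : nat -> R) :
  0 <= A -> l1_bounded u r 1 -> `|h| <= r / 2 ->
  (forall d, (d < k)%N -> l1_bounded (b d) r A) ->
  (forall d, (d < k)%N -> pseries (b d) h @ \oo --> y d) ->
  pseries u h @ \oo --> x ->
  pseries (horner_series b k u) h @ \oo --> \sum_(d < k) y d * x ^+ d.
Proof.
move=> A0 u1 hr; elim: k b y => [|k IH] b y bA bc ux /=.
  rewrite big_ord0; apply: cvg_near_cst; apply: filterE => N.
  by rewrite pseriesE big1 // => i _; rewrite mul0r.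
rewrite big_ord_recl expr0 mulr1; apply: cvg_pseriesD; first exact: bc.
have -> : \sum_(i < k) y (lift ord0 i) * x ^+ lift ord0 i =
    x * \sum_(i < k) y i.+1 * x ^+ i.
  by rewrite mulr_sumr; apply: eq_bigr => i _; rewrite /= /bump add1n exprS mulrCA.
have r0 : 0 <= r by have := le_trans (normr_ge0 h) hr; lra.
apply: (@cvg_pseriesM _ _ _ r 1 (A * k%:R)) => //.
  by apply: l1_bounded_horner_series => // d dk; exact: bA.
apply: (IH (fun d => b d.+1) (fun d => y d.+1)) => // d dk; [exact: bA|exact: bc].
Qed.

Lemma l1_bounded_small c r s A : 0 < r -> 0 <= s <= r -> c 0%N = 0 ->
  l1_bounded c r A -> l1_bounded c s (A * (s / r)).
Proof.
move=> r0 /andP[s0 sr] c0 cA N.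
apply: le_trans (_ : (\sum_(k < N) `|c k| * r ^+ k) * (s / r) <= _); last first.
  by apply: ler_wpM2r; rewrite ?divr_ge0 // ltW.
rewrite mulr_suml; apply: ler_sum => -[[|k] /= _] _.
  by rewrite c0 normr0 !mul0r.
rewrite -mulrA; apply: ler_wpM2l => //.
rewrite exprSr [in leRHS]exprSr -mulrA [r * _]mulrC divfK ?gt_eqF //.
by apply: ler_wpM2r => //; apply: lerXn2r; rewrite ?nnegrE // ltW.
Qed.

Lemma common_expansion (b : nat -> R -> R) a K :
  (forall d, real_analytic_at (b d) a) ->
  exists (c : nat -> nat -> R) r A,
    0 < r /\ 0 <= A /\ forall d, (d < K)%N -> expands (b d) a (c d) r A.
Proof.
move=> ba; elim: K => [|K [c [r [A [r0 [A0 IH]]]]]].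
  by exists (fun _ _ => 0), 1, 0.
have [e [s [B be]]] := real_analytic_expands (ba K).
have s0 : 0 < s by case: be.
have B0 : 0 <= B by case: be => _ /l1_bounded_ge0.
have m0 : 0 < Num.min r s by rewrite lt_min r0.
exists (fun d => if (d < K)%N then c d else e), (Num.min r s), (A + B).
split=> //; split; first exact: addr_ge0.
move=> d; rewrite ltnS leq_eqVlt => /orP[/eqP ->|dK].
  rewrite ltnn; apply: (@expandsW _ _ _ _ _ B); first by rewrite lerDr.
  by apply: expands_radius be; rewrite m0 ge_min lexx orbT.
rewrite dK; apply: (@expandsW _ _ _ _ _ A); first by rewrite lerDl.
by apply: expands_radius (IH d dK); rewrite m0 ge_min lexx.
Qed.

(** The fixed point [u] is computed coefficient by coefficient, each step of the
    iteration fixing one more coefficient. It converges because, at a small enough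
    radius [s], the iteration maps the ball of radius [e] of the weighted
    l1 norm to itself. *)
Lemma real_analytic_fixpoint (b : nat -> R -> R) (D : nat) (a g : R) :
  (forall d, real_analytic_at (b d) a) -> b 0%N a = 0 -> b 1%N a = 0 ->
  exists u : R -> R, [/\ real_analytic_at u a, u a = 0 &
    \forall t \near a, u t = g * \sum_(d < D.+2) b d t * u t ^+ d].
Proof.
move=> ba b0 b1.
have [c [r [A [r0 [A0 bc]]]]] := common_expansion D.+2 ba.
have c0 : c 0%N 0%N = 0 by rewrite -(expands0 (bc 0%N _)).
have c1 : c 1%N 0%N = 0 by rewrite -(expands0 (bc 1%N _)).
pose G := `|g| * A.
have G0 : 0 <= G by rewrite mulr_ge0.
have GD0 : 0 <= G * D%:R by rewrite mulr_ge0.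
(* The image of the ball of radius [e] has norm at most [G q + e G q + e ^ 2 G D];
   the choices of [e] and [q] make each summand at most [e / 3]. *)
pose e := (3 * (G * D%:R + 1))^-1.
have e0 : 0 < e by rewrite invr_gt0; lra.
have eE : 3 * (G * D%:R + 1) * e = 1 by rewrite mulfV //; apply/eqP; lra.
have e1 : e <= 1 by nra.
pose q := e / (3 * (G + 1)).
have q0 : 0 < q by rewrite divr_gt0 //; lra.
have qE : 3 * (G + 1) * q = e by rewrite mulrC divfK //; apply/eqP; lra.
have q1 : q <= 1 by nra.
pose s := r * q.
have s0 : 0 < s by rewrite mulr_gt0.
have sr : s <= r by rewrite ler_piMr // ltW.
have s0r : 0 <= s <= r by rewrite ltW.
have srq : s / r = q by rewrite /s mulrC mulKf ?gt_eqF.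
have cs d : (d < D.+2)%N -> l1_bounded (c d) s A.
  by move=> dD; case: (bc d dD) => _ cA _; exact: l1_bounded_radius cA.
pose T u := fun k => g * horner_series c D.+2 u k.
have T0 u : u 0%N = 0 -> T u 0%N = 0.
  by move=> u0; rewrite /T /= c0 /cauchy_prod big_ord1 u0 mul0r addr0 mulr0.
have Te u : l1_bounded u s e -> l1_bounded (T u) s e.
  move=> ue; have u1 := l1_boundedW e1 ue.
  apply: (@l1_boundedW _ _ _ (`|g| * (A * q + e * (A * q + e * (A * D%:R))))).
    rewrite (_ : `|g| * _ = G * q + e * (G * q) + e * e * (G * D%:R)); last first.
      by rewrite /G; ring.
    have : G * q <= e / 3 by nra.
    have : e * (G * D%:R) <= 3^-1 by nra.
    by move=> h1 h2; nra.
  apply: l1_boundedZ; apply: l1_boundedD; first exact: ltW.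
    by rewrite -srq; apply: (@l1_bounded_small _ r) => //; case: (bc 0%N).
  apply: l1_bounded_cauchy_prod => //; first exact: ltW.
  apply: l1_boundedD; first exact: ltW.
    by rewrite -srq; apply: (@l1_bounded_small _ r) => //; case: (bc 1%N).
  apply: l1_bounded_cauchy_prod => //; first exact: ltW.
  by apply: l1_bounded_horner_series => //; [exact: ltW|move=> d dD; exact: cs].
have Tagree m u v : u 0%N = 0 -> v 0%N = 0 -> agree_below m u v ->
    agree_below m.+1 (T u) (T v).
  move=> u0 v0 uv k km; rewrite /T /=; congr (_ * (_ + _)).
  apply: agree_cauchy_prod0 km => //.
  - by rewrite c1 /cauchy_prod big_ord1 u0 mul0r addr0.
  - by rewrite c1 /cauchy_prod big_ord1 v0 mul0r addr0.
  - exact: (@agree_horner_series (fun d => c d.+1) D.+1).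
pose U n := iter n T (fun=> 0).
have U0 n : U n 0%N = 0 by elim: n => // n IH; rewrite /U iterS; exact: T0.
have Ue n : l1_bounded (U n) s e.
  elim: n => [|n IH]; last exact: Te.
  by move=> N; rewrite big1 ?ltW // => i _; rewrite normr0 mul0r.
have US n : agree_below n.+1 (U n) (U n.+1).
  elim: n => [|n IH]; last exact: (Tagree n.+1 (U n) (U n.+1)).
  by move=> [|//] _; rewrite !U0.
have UA n m : (n <= m)%N -> agree_below n.+1 (U n) (U m).
  move=> /subnK <-; elim: (m - n)%N => // k IH i ik.
  by rewrite IH // US // ltnS (leq_trans _ (leq_addl _ _)).
(* The coefficient of index [k] is final after [k] iterations. *)
pose u k := U k k.
have uU n : agree_below n.+1 u (U n) by move=> k; rewrite ltnS => kn; exact: UA.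
have uT k : u k = T u k.
  have -> : T u k = T (U k) k.
    apply: (Tagree k u (U k)) => //; try exact: (U0 0%N).
    by move=> i ik; apply: uU; exact: ltnW.
  by apply: (uU k.+1); exact: ltnW.
have ue : l1_bounded u s e.
  move=> N; apply: le_trans (Ue N N); apply: ler_sum => i _.
  by rewrite (uU N) // ltnS ltnW.
have uex : expands (fun t => psum u (t - a)) a u s e.
  by split=> // h hs; rewrite addrAC subrr add0r; exact: psumP ue hs.
exists (fun t => psum u (t - a)); split.
- exact: expands_real_analytic uex.
- by rewrite (expands0 uex).
- apply/near_shift0; apply/nbhs_ballP; exists (s / 2) => /=; first by lra.
  move=> h; rewrite /ball /= sub0r normrN addrAC subrr add0r => /ltW hs.
  have hs' : `|h| <= s by lra.
  have ux := psumP ue hs'.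
  have bh d : (d < D.+2)%N -> pseries (c d) h @ \oo --> b d (a + h).
    by move=> dD; case: (bc d dD) => _ _; apply; exact: le_trans sr.
  have Tx := cvg_pseriesZ (a := g) (cvg_horner_series A0 (l1_boundedW e1 ue) hs cs bh ux).
  have Tu : (fun k => g * horner_series c D.+2 u k) = u by rewrite [RHS](funext uT).
  by rewrite Tu in Tx; exact: cvg_unique ux Tx.
Qed.

(** With the coefficients [b d] of a polynomial expanded around a simple root, the
    linear term is [b 1 a] times the unknown up to a small error; solving for it
    turns the equation into the fixed point problem above. *)
Lemma real_analytic_implicit (b : nat -> R -> R) (D : nat) (a : R) :
  (forall d, real_analytic_at (b d) a) -> b 0%N a = 0 -> b 1%N a != 0 ->
  exists u : R -> R, [/\ real_analytic_at u a, u a = 0 &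
    \forall t \near a, \sum_(d < D.+2) b d t * u t ^+ d = 0].
Proof.
move=> ba b0 b1.
pose b' d t := if d == 1%N then b 1%N t + - b 1%N a else b d t.
have [||| u [ua u0 uf]] := @real_analytic_fixpoint b' D a (- (b 1%N a)^-1).
- move=> d; rewrite /b'; case: (d == 1%N) => //.
  by apply: real_analyticD => //; exact: real_analytic_cst.
- exact: b0.
- by rewrite /b' /= subrr.
exists u; split=> //; apply: filterS uf => t.
rewrite !(big_ord_recl D.+1) !(big_ord_recl D) /= /b' /=.
set S := \sum_(i < D) _;
rewrite !expr0 !expr1 => /(congr1 ( *%R (b 1%N a))).
by rewrite mulrA mulrN mulfV //; lra.
Qed.
End ImplicitFunction.

(** * Boolean operations on semialgebraic sets *)
Section SemialgebraicBoolean.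
Local Open Scope classical_set_scope.
Local Open Scope ring_scope.
Context {R : realType} {n : nat}.
Implicit Types (A B : set 'rV[R]_n) (p : mpoly n R).

Lemma semialgebraic_ext A B :
  (forall x, A x <-> B x) -> semialgebraic A -> semialgebraic B.
Proof. by move=> AB [s As]; exists s; rewrite -As; apply/seteqP; split=> x /AB. Qed.

Lemma semialgebraic0 : semialgebraic (set0 : set 'rV[R]_n).
Proof. by exists [::]; apply/seteqP; split=> x //= []. Qed.

Lemma semialgebraicT : semialgebraic (setT : set 'rV[R]_n).
Proof.
exists [:: ([::], [::])]; apply/seteqP; split=> x //= _.
by exists ([::], [::]); rewrite ?inE.
Qed.

Lemma semialgebraicU A B :
  semialgebraic A -> semialgebraic B -> semialgebraic (A `|` B).
Proof.
move=> [s ->] [t ->]; exists (s ++ t); apply/seteqP; split=> x /=.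
  by move=> [[b bs bx]|[b bs bx]]; exists b => //; rewrite mem_cat bs ?orbT.
by move=> [b]; rewrite mem_cat => /orP[bs|bs] bx; [left|right]; exists b.
Qed.

Lemma semialgebraicI A B :
  semialgebraic A -> semialgebraic B -> semialgebraic (A `&` B).
Proof.
move=> [s ->] [t ->].
exists [seq (b.1 ++ c.1, b.2 ++ c.2) | b <- s, c <- t].
apply/seteqP; split=> x /=.
  move=> [[b bs [b0 b1]] [c ct [c0 c1]]]; exists (b.1 ++ c.1, b.2 ++ c.2).
    by apply/allpairsP; exists (b, c).
  by split=> f /=; rewrite mem_cat => /orP[]; auto.
move=> [_ /allpairsP[[b c] /= [bs ct ->]] [h0 h1]]; split.
  by exists b => //; split=> f fb; [apply: h0|apply: h1]; rewrite /= mem_cat fb.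
by exists c => //; split=> f fb; [apply: h0|apply: h1]; rewrite /= mem_cat fb orbT.
Qed.

Lemma semialgebraic_eq0 p : semialgebraic [set x : 'rV[R]_n | poly_at x p = 0].
Proof.
exists [:: ([:: p], [::])]; apply/seteqP; split=> x /=.
  move=> px; exists ([:: p], [::]); first by rewrite inE.
  by split=> f //=; rewrite inE => /eqP ->.
by move=> [b]; rewrite inE => /eqP -> [/= + _]; apply; rewrite inE.
Qed.

Lemma semialgebraic_gt0 p : semialgebraic [set x : 'rV[R]_n | 0 < poly_at x p].
Proof.
exists [:: ([::], [:: p])]; apply/seteqP; split=> x /=.
  move=> px; exists ([::], [:: p]); first by rewrite inE.
  by split=> f //=; rewrite inE => /eqP ->.
by move=> [b]; rewrite inE => /eqP -> [/= _]; apply; rewrite inE.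
Qed.

Lemma semialgebraic_lt0 p : semialgebraic [set x : 'rV[R]_n | poly_at x p < 0].
Proof.
apply: semialgebraic_ext (semialgebraic_gt0 (- p)) => x /=.
by rewrite /poly_at mevalN oppr_gt0.
Qed.

Lemma semialgebraicC A : semialgebraic A -> semialgebraic (~` A).
Proof.
move=> [s ->]; elim: s => [|[u v] s IH].
  by apply: semialgebraic_ext semialgebraicT => x; split=> // _ [].
have hu : semialgebraic [set x : 'rV[R]_n | exists2 f, f \in u & poly_at x f <> 0].
  elim: u => [|f u IHu].
    by apply: semialgebraic_ext semialgebraic0 => x; split=> // -[].
  have := semialgebraicU (semialgebraicU (semialgebraic_gt0 f) (semialgebraic_lt0 f)) IHu.
  apply: semialgebraic_ext => x; split=> /=.
    move=> [[fx|fx]|[g gu gx]]; last by exists g => //; rewrite inE gu orbT.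
      by exists f; [rewrite inE eqxx|apply/eqP; rewrite gt_eqF].
    by exists f; [rewrite inE eqxx|apply/eqP; rewrite lt_eqF].
  move=> [g]; rewrite inE => /orP[/eqP -> /eqP|gu gx]; last by right; exists g.
  by rewrite neq_lt => /orP[]; left; [right|left].
have hv : semialgebraic [set x : 'rV[R]_n | exists2 f, f \in v & ~ 0 < poly_at x f].
  elim: v => [|f v IHv].
    by apply: semialgebraic_ext semialgebraic0 => x; split=> // -[].
  have := semialgebraicU (semialgebraicU (semialgebraic_eq0 f) (semialgebraic_lt0 f)) IHv.
  apply: semialgebraic_ext => x; split=> /=.
    move=> [[fx|fx]|[g gu gx]]; last by exists g => //; rewrite inE gu orbT.
      by exists f; [rewrite inE eqxx|rewrite fx ltxx].
    by exists f; [rewrite inE eqxx|apply/negP; rewrite -leNgt ltW].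
  move=> [g]; rewrite inE => /orP[/eqP -> /negP|gu gx]; last by right; exists g.
  by rewrite -leNgt le_eqVlt => /orP[/eqP|]; left; [left|right].
apply: semialgebraic_ext (semialgebraicI (semialgebraicU hu hv) IH) => x; split=> /=.
  move=> [uv ns] [b]; rewrite inE => /orP[/eqP -> [/= u0 v0]|bs bx].
    by case: uv => -[f fu]; [move/(_ (u0 f fu))|move/(_ (v0 f fu))].
  by apply: ns; exists b.
move=> ns; split; last by move=> [b bs bx]; apply: ns; exists b => //; rewrite inE bs orbT.
apply: contrapT => /not_orP[nu nv]; apply: ns; exists (u, v); first by rewrite inE eqxx.
by split=> f fu /=; apply: contrapT => fx; [apply: nu|apply: nv]; exists f.
Qed.

Lemma semialgebraicD A B :
  semialgebraic A -> semialgebraic B -> semialgebraic (A `\` B).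
Proof. by move=> hA hB; apply: semialgebraicI => //; exact: semialgebraicC. Qed.

Lemma semialgebraic_bigcup (I : eqType) (s : seq I) (F : I -> set 'rV[R]_n) :
  (forall i, i \in s -> semialgebraic (F i)) ->
  semialgebraic [set x | exists2 i, i \in s & F i x].
Proof.
elim: s => [|i s IH] Fs.
  by apply: semialgebraic_ext semialgebraic0 => x; split=> // -[].
have Fs' j : j \in s -> semialgebraic (F j) by move=> js; apply: Fs; rewrite inE js orbT.
have := semialgebraicU (Fs i (mem_head _ _)) (IH Fs'); apply: semialgebraic_ext => x /=; split.
  by move=> [Fx|[j js Fx]]; [exists i|exists j]; rewrite ?inE ?eqxx ?js ?orbT.
by move=> [j]; rewrite inE => /orP[/eqP ->|js] Fx; [left|right; exists j].
Qed.
End SemialgebraicBoolean.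

(** * First-order definability *)
Section Definability.
Local Open Scope classical_set_scope.
Local Open Scope ring_scope.
Context {R : realType}.
Implicit Types (P Q : seq R -> Prop) (T : seq R -> R).

(** Real variables are coordinates of an environment [e], read as [nth 0 e k]. *)
Definition definable P := exists f : formula R, forall e, P e <-> holds e f.

Definition polynomial_term T := exists t : GRing.term R, forall e, GRing.eval e t = T e.

Lemma polynomial_term_var k : polynomial_term (fun e => nth 0 e k).
Proof. by exists (GRing.Var _ k). Qed.

Lemma polynomial_term_const c : polynomial_term (fun=> c).
Proof. by exists (GRing.Const c). Qed.

Lemma polynomial_termM T T' : polynomial_term T -> polynomial_term T' ->
  polynomial_term (fun e => T e * T' e).
Proof. by move=> [t tT] [t' tT']; exists (GRing.Mul t t') => e /=; rewrite tT tT'. Qed.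

Lemma polynomial_termX T k : polynomial_term T -> polynomial_term (fun e => T e ^+ k).
Proof. by move=> [t tT]; exists (GRing.Exp t k) => e /=; rewrite tT. Qed.

Lemma polynomial_term_sum (I : Type) (s : seq I) (F : I -> seq R -> R) :
  (forall i, polynomial_term (F i)) ->
  polynomial_term (fun e => \sum_(i <- s) F i e).
Proof.
move=> FT; elim: s => [|i s [t tT]].
  by exists (GRing.Const 0) => e; rewrite big_nil.
have [u uT] := FT i.
by exists (GRing.Add u t) => e; rewrite big_cons /= uT tT.
Qed.

Lemma polynomial_term_prod (I : Type) (s : seq I) (F : I -> seq R -> R) :
  (forall i, polynomial_term (F i)) ->
  polynomial_term (fun e => \prod_(i <- s) F i e).
Proof.
move=> FT; elim: s => [|i s [t tT]].
  by exists (GRing.Const 1) => e; rewrite big_nil.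
have [u uT] := FT i.
by exists (GRing.Mul u t) => e; rewrite big_cons /= uT tT.
Qed.

Lemma definable_ext P Q : (forall e, P e <-> Q e) -> definable P -> definable Q.
Proof. by move=> PQ [f Pf]; exists f => e; rewrite -PQ. Qed.

Lemma definable_eq T T' : polynomial_term T -> polynomial_term T' ->
  definable (fun e => T e = T' e).
Proof.
by move=> [t tT] [t' tT']; exists (ordered_qelim.ord.Equal t t') => e /=; rewrite tT tT'.
Qed.

Lemma definable_lt T T' : polynomial_term T -> polynomial_term T' ->
  definable (fun e => T e < T' e).
Proof. by move=> [t tT] [t' tT']; exists (ordered_qelim.ord.Lt t t') => e /=; rewrite tT tT'. Qed.

Lemma definable_and P Q : definable P -> definable Q -> definable (fun e => P e /\ Q e).
Proof. by move=> [f Pf] [g Qg]; exists (ordered_qelim.ord.And f g) => e /=; rewrite Pf Qg. Qed.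

Lemma definable_or P Q : definable P -> definable Q -> definable (fun e => P e \/ Q e).
Proof. by move=> [f Pf] [g Qg]; exists (ordered_qelim.ord.Or f g) => e /=; rewrite Pf Qg. Qed.

Lemma definable_not P : definable P -> definable (fun e => ~ P e).
Proof. by move=> [f Pf]; exists (ordered_qelim.ord.Not f) => e /=; rewrite Pf. Qed.

(** The bound variable is stored at the index [k]; the side condition says that
    the family [P] reads it there and nowhere else. *)
Lemma definable_exists k Q (P : seq R -> R -> Prop) :
  (forall e y, Q (set_nth 0 e k y) <-> P e y) ->
  definable Q -> definable (fun e => exists y, P e y).
Proof.
move=> QP [f Qf]; exists (ordered_qelim.ord.Exists k f) => e /=.
by split=> -[y hy]; exists y; [rewrite -Qf QP|rewrite -QP Qf].
Qed.

Definition env_point n (e : seq R) : 'rV[R]_n := \row_i nth 0 e i.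
Definition point_env n (x : 'rV[R]_n) : seq R := [seq x ord0 i | i <- enum 'I_n].

Lemma env_pointK n (x : 'rV[R]_n) : env_point n (point_env x) = x.
Proof.
apply/rowP => i; rewrite mxE (nth_map i) ?size_enum_ord //.
by congr (x _ _); apply/val_inj; rewrite /= nth_enum_ord.
Qed.

Lemma polynomial_term_poly_at n (p : mpoly n R) :
  polynomial_term (fun e => poly_at (env_point n e) p).
Proof.
rewrite (_ : (fun e => _) = fun e => \sum_(m <- msupp p)
  (mcoeff m p * \prod_i nth 0 e (i : 'I_n) ^+ m i)); last first.
  apply/funext => e; rewrite /poly_at mevalE; apply: eq_bigr => m _.
  by congr (_ * _); apply: eq_bigr => i _; rewrite mxE.
apply: polynomial_term_sum => m; apply: polynomial_termM.
  exact: polynomial_term_const.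
by apply: polynomial_term_prod => i; apply/polynomial_termX/polynomial_term_var.
Qed.

Lemma semialgebraic_definable n (A : set 'rV[R]_n) :
  semialgebraic A -> definable (fun e => A (env_point n e)).
Proof.
have dF : definable (fun=> False) by exists (ordered_qelim.ord.Bool false).
have dT : definable (fun=> True) by exists (ordered_qelim.ord.Bool true).
have d0 := polynomial_term_const 0.
move=> [s ->]; elim: s => [|[u v] s IH] /=.
  by apply: definable_ext dF => e; split=> // -[].
have hu : definable (fun e => forall f, f \in u -> poly_at (env_point n e) f = 0).
  elim: u => [|f u IHu]; first by apply: definable_ext dT.
  have := definable_and (definable_eq (polynomial_term_poly_at f) d0) IHu.
  apply: definable_ext => e; split=> [[fe ue] g|ue].
    by rewrite inE => /orP[/eqP -> //|]; exact: ue.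
  by split=> [|g gu]; apply: ue; rewrite inE ?eqxx ?gu ?orbT.
have hv : definable (fun e => forall f, f \in v -> 0 < poly_at (env_point n e) f).
  elim: v => [|f v IHv]; first by apply: definable_ext dT.
  have := definable_and (definable_lt d0 (polynomial_term_poly_at f)) IHv.
  apply: definable_ext => e; split=> [[fe ve] g|ve].
    by rewrite inE => /orP[/eqP -> //|]; exact: ve.
  by split=> [|g gv]; apply: ve; rewrite inE ?eqxx ?gv ?orbT.
apply: definable_ext (definable_or (definable_and hu hv) IH) => e; split.
  move=> [h|[b bs bx]]; first by exists (u, v); rewrite ?inE ?eqxx.
  by exists b; rewrite ?inE ?bs ?orbT.
by move=> [b]; rewrite inE => /orP[/eqP ->|bs] bx; [left|right; exists b].
Qed.

Lemma rterm_polynomial n (t : GRing.term R) : GRing.rterm t ->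
  exists p : mpoly n R, forall x, GRing.eval (point_env x) t = poly_at x p.
Proof.
rewrite /poly_at; elim: t => //=.
- move=> k _; case: (ltnP k n) => kn.
    exists (mpolyX R (mnm1 (Ordinal kn))) => x; rewrite mevalXU.
    rewrite (nth_map (Ordinal kn)) ?size_enum_ord //; congr (x _ _).
    by apply/val_inj; rewrite /= nth_enum_ord.
  by exists 0 => x; rewrite meval0 nth_default // size_map size_enum_ord.
- by move=> c _; exists (mpolyC n c) => x; rewrite mevalC.
- by move=> k _; exists (mpolyC n k%:R) => x; rewrite mevalC.
- move=> t IHt u IHu /andP[/IHt[p pt] /IHu[q qu]]; exists (p + q) => x.
  by rewrite pt qu mevalD.
- by move=> t IHt /IHt[p pt]; exists (- p) => x; rewrite pt mevalN.
- by move=> t IHt k /IHt[p pt]; exists (p *+ k) => x; rewrite pt mevalMn.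
- move=> t IHt u IHu /andP[/IHt[p pt] /IHu[q qu]]; exists (p * q) => x.
  by rewrite pt qu mevalM.
- by move=> t IHt k /IHt[p pt]; exists (p ^+ k) => x; rewrite pt rmorphXn.
Qed.

Lemma qf_semialgebraic n (f : formula R) :
  ordered_qelim.ord.qf_form f && ordered_qelim.ord.rformula f ->
  semialgebraic [set x : 'rV[R]_n | ordered_qelim.ord.qf_eval (point_env x) f].
Proof.
have cmp t u : GRing.rterm t && GRing.rterm u -> exists p : mpoly n R,
    forall x, GRing.eval (point_env x) t - GRing.eval (point_env x) u = poly_at x p.
  move=> /andP[/(rterm_polynomial n)[p pt] /(rterm_polynomial n)[q qu]].
  by exists (p - q) => x; rewrite pt qu /poly_at mevalB.
elim: f => //=.
- case=> _; first by apply: semialgebraic_ext semialgebraicT.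
  by apply: semialgebraic_ext semialgebraic0.
- move=> t u /cmp[p pE]; apply: semialgebraic_ext (semialgebraic_eq0 p) => x /=.
  by rewrite -pE -subr_eq0; split=> [->|/eqP].
- move=> t u /cmp[p pE]; apply: semialgebraic_ext (semialgebraic_lt0 p) => x /=.
  by rewrite -pE subr_lt0.
- move=> t u /cmp[p pE].
  apply: semialgebraic_ext (semialgebraicC (semialgebraic_gt0 p)) => x /=.
  by rewrite -pE subr_gt0 leNgt; split=> /negP.
- move=> f IHf g IHg; rewrite andbACA => /andP[/IHf hf /IHg hg].
  apply: semialgebraic_ext (semialgebraicI hf hg) => x /=.
  by split=> [[-> ->]|/andP].
- move=> f IHf g IHg; rewrite andbACA => /andP[/IHf hf /IHg hg].
  apply: semialgebraic_ext (semialgebraicU hf hg) => x /=.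
  by split=> [|/orP//] => /orP.
- move=> f IHf g IHg; rewrite andbACA => /andP[/IHf hf /IHg hg].
  apply: semialgebraic_ext (semialgebraicU (semialgebraicC hf) hg) => x /=.
  split=> [[/negP/negbTE -> //|->]|]; first by rewrite implybT.
  by rewrite implybE => /orP[/negP|]; [left|right].
- move=> f IHf /IHf hf; apply: semialgebraic_ext (semialgebraicC hf) => x /=.
  by split=> /negP.
Qed.

(** Quantifier elimination over the real closed field [R]. *)
Lemma definable_semialgebraic n (A : set 'rV[R]_n) :
  definable (fun e => A (env_point n e)) -> semialgebraic A.
Proof.
move=> [f Af]; pose g := ordered_qelim.ord.to_rform f.
have gf := ordered_qelim.ord.quantifier_elim_wf (@qe_rcf.wf_QE_wproj R)
  (ordered_qelim.ord.to_rform_rformula f).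
apply: semialgebraic_ext (qf_semialgebraic n gf) => x /=.
rewrite -{2}(env_pointK x) Af; split=> /(qe_rcf.rcf_satP _ _) //.
Qed.
End Definability.

(** * Fibres over the first [n] coordinates *)
Section Fibres.
Local Open Scope classical_set_scope.
Local Open Scope ring_scope.
Context {R : realType} {n : nat}.
Implicit Types (x : 'rV[R]_n) (v : 'rV[R]_n.+1) (A Z : set 'rV[R]_n.+1) (y : R).

Definition extend x y : 'rV[R]_n.+1 :=
  \row_i if unlift ord_max i is Some j then x ord0 j else y.

Definition base v : 'rV[R]_n := \row_i v ord0 (lift ord_max i).

Definition height v : R := v ord0 ord_max.

Lemma extendK x y : base (extend x y) = x.
Proof. by apply/rowP => i; rewrite !mxE liftK. Qed.

Lemma height_extend x y : height (extend x y) = y.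
Proof. by rewrite /height mxE unlift_none. Qed.

Lemma extend_base v : extend (base v) (height v) = v.
Proof.
apply/rowP => i; rewrite !mxE.
by case: unliftP => [j ->|->]; rewrite ?mxE.
Qed.

Lemma env_pointS e : env_point n.+1 e = extend (env_point n e) (nth 0 e n).
Proof.
apply/rowP => i; rewrite !mxE; case: unliftP => [j ->|->] //.
by rewrite mxE lift_max.
Qed.

Lemma env_point_set k e y : (n <= k)%N ->
  env_point n (set_nth 0 e k y) = env_point n e.
Proof.
move=> nk; apply/rowP => i; rewrite !mxE nth_set_nth /=.
by rewrite ltn_eqF // (leq_trans _ nk).
Qed.

Lemma definable_fibre A k : (n < k)%N -> semialgebraic A ->
  definable (fun e => A (extend (env_point n e) (nth 0 e k))).
Proof.
move=> nk /semialgebraic_definable dA.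
have dE := definable_eq (polynomial_term_var n) (polynomial_term_var (R := R) k).
have := @definable_exists _ n _
  (fun e y => y = nth 0 e k /\ A (extend (env_point n e) y)) _ (definable_and dE dA).
move=> /(_ _)/(definable_ext _); apply=> [e|e y].
  by split=> [[y [-> //]]|ek]; exists (nth 0 e k).
by rewrite env_pointS env_point_set // !nth_set_nth /= eqxx gtn_eqF.
Qed.

(** Tarski-Seidenberg: quantifier elimination in geometric form. *)
Lemma semialgebraic_proj A : semialgebraic A ->
  semialgebraic [set x | exists y, A (extend x y)].
Proof.
move=> /semialgebraic_definable dA; apply: definable_semialgebraic.
apply: (definable_exists (k := n)) dA => e y.
by rewrite env_pointS env_point_set // nth_set_nth /= eqxx.
Qed.

Lemma semialgebraic_base (B : set 'rV[R]_n) : semialgebraic B ->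
  semialgebraic [set v | B (base v)].
Proof.
move=> /semialgebraic_definable dB; apply: definable_semialgebraic.
by apply: definable_ext dB => e; rewrite env_pointS /= extendK.
Qed.

Lemma semialgebraic_forall_fibre A A' : semialgebraic A -> semialgebraic A' ->
  semialgebraic [set x | forall y, A (extend x y) -> A' (extend x y)].
Proof.
move=> sA sA'; have := semialgebraicC (semialgebraic_proj (semialgebraicD sA sA')).
apply: semialgebraic_ext => x; split=> /= [nex y Axy|h [y [/h]] //].
by apply: contrapT => nA'; apply: nex; exists y.
Qed.

Definition above A : set 'rV[R]_n.+1 :=
  [set v | exists y, y < height v /\ A (extend (base v) y)].

Definition below A : set 'rV[R]_n.+1 :=
  [set v | exists y, height v < y /\ A (extend (base v) y)].

Lemma semialgebraic_above A : semialgebraic A -> semialgebraic (above A).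
Proof.
move=> sA; apply: definable_semialgebraic.
have dA := definable_fibre (ltnSn n) sA.
have dl := definable_lt (polynomial_term_var (R := R) n.+1) (polynomial_term_var n).
apply: (definable_exists (k := n.+1)) (definable_and dl dA) => e y.
rewrite env_pointS extendK height_extend env_point_set // !nth_set_nth /= eqxx.
by rewrite ltn_eqF.
Qed.

Lemma semialgebraic_below A : semialgebraic A -> semialgebraic (below A).
Proof.
move=> sA; apply: definable_semialgebraic.
have dA := definable_fibre (ltnSn n) sA.
have dl := definable_lt (polynomial_term_var (R := R) n) (polynomial_term_var n.+1).
apply: (definable_exists (k := n.+1)) (definable_and dl dA) => e y.
rewrite env_pointS extendK height_extend env_point_set // !nth_set_nth /= eqxx.
by rewrite ltn_eqF.
Qed.

(** * Enumeration of finite fibres in increasing order *)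

(** Having a smaller point in the same fibre is a first-order condition, so each
    stage is semialgebraic, and the [j]-th lowest point of a fibre is what
    distinguishes two consecutive stages. *)
Fixpoint drop_lowest j Z : set 'rV[R]_n.+1 :=
  if j is j'.+1 then drop_lowest j' Z `&` above (drop_lowest j' Z) else Z.

Lemma semialgebraic_drop_lowest j Z : semialgebraic Z -> semialgebraic (drop_lowest j Z).
Proof.
move=> sZ; elim: j => //= j IH; apply: semialgebraicI => //.
exact: semialgebraic_above.
Qed.

Definition enumerates (s : 'rV[R]_n -> seq R) Z :=
  forall x, sorted <%R (s x) /\ forall y, Z (extend x y) <-> y \in s x.

Lemma drop_lowestE s Z j x y : enumerates s Z ->
  drop_lowest j Z (extend x y) <-> y \in drop j (s x).
Proof.
move=> /(_ x)[]; set l := s x => sl lZ; elim: j y => [|j IH] y /=.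
  by rewrite drop0.
have IH' : (exists z, z < y /\ drop_lowest j Z (extend x z)) <->
           exists2 z, z < y & z \in drop j l.
  by split=> [[z [zy /IH]]|[z zy zl]]; exists z => //; split=> //; apply/IH.
rewrite /above /setI /= height_extend extendK IH IH' {IH IH'}.
case: (ltnP j (size l)) => jl; last first.
  by rewrite !drop_oversize ?(leq_trans jl) // in_nil; split=> [[]|].
have sd : sorted <%R (drop j l) by exact: drop_sorted.
move: sd; rewrite (drop_nth 0 jl) /= (path_sortedE lt_trans) => /andP[/allP al _].
split=> [[yl [z zy zl]]|yl].
  move: yl; rewrite inE => /orP[/eqP yE|//].
  move: zl; rewrite inE => /orP[/eqP zE|/al].
    by move: zy; rewrite yE zE ltxx.
  by rewrite -yE => /lt_trans /(_ zy); rewrite ltxx.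
split; first by rewrite inE yl orbT.
by exists (nth 0 l j); [exact: al|rewrite mem_head].
Qed.

Lemma semialgebraic_nth_fibre s Z j : enumerates s Z -> semialgebraic Z ->
  semialgebraic [set v | (j < size (s (base v)))%N /\ height v = nth 0 (s (base v)) j].
Proof.
move=> sZ saZ.
have := semialgebraicD (semialgebraic_drop_lowest j saZ)
  (semialgebraic_drop_lowest j.+1 saZ).
apply: semialgebraic_ext => v.
apply: (@iff_trans _
  (height v \in drop j (s (base v)) /\ ~ height v \in drop j.+1 (s (base v)))).
  have h i := drop_lowestE i (base v) (height v) sZ.
  by rewrite -!h extend_base.
rewrite /=.
have [+ _] := sZ (base v); move: (s _) (height v) => l y sl.
case: (ltnP j (size l)) => jl; last first.
  by rewrite !drop_oversize ?(leq_trans jl) // in_nil; split=> -[].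
have : sorted <%R (drop j l) by exact: drop_sorted.
rewrite (drop_nth 0 jl) /= (path_sortedE lt_trans) => /andP[/allP al _].
rewrite inE; split=> [[/orP[/eqP //|->]]|[_ ->]] //.
by rewrite eqxx; split=> // /al; rewrite ltxx.
Qed.

Lemma semialgebraic_size_fibre s Z m : enumerates s Z -> semialgebraic Z ->
  semialgebraic [set x | size (s x) = m].
Proof.
move=> sZ saZ.
have sp j := semialgebraic_proj (semialgebraic_drop_lowest j saZ).
have ge j : semialgebraic [set x | (j < size (s x))%N].
  apply: semialgebraic_ext (sp j) => x /=; split=> [[y]|jl].
    rewrite (drop_lowestE _ _ _ sZ); case: ltnP => // jl.
    by rewrite drop_oversize.
  exists (nth 0 (s x) j); rewrite (drop_lowestE _ _ _ sZ).
  by rewrite (drop_nth 0 jl) mem_head.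
case: m => [|m].
  apply: semialgebraic_ext (semialgebraicC (ge 0%N)) => x /=.
  by rewrite lt0n; split=> [/negP/negPn/eqP|->].
apply: semialgebraic_ext (semialgebraicD (ge m) (ge m.+1)) => x; rewrite /setD /=.
split=> [[h1 /negP]|->]; last by rewrite leqnn ltnn.
by rewrite -leqNgt => h2; apply/eqP; rewrite eqn_leq h2.
Qed.

(** A local condition, preserved by unions: which continuation is which is only
    decided later, by counting the points of the fibres. *)
Definition arc_continuable Z :=
  forall (g : R -> 'rV[R]_n) (t0 y : R),
  (forall i, real_analytic_at (fun t => g t ord0 i) t0) -> Z (extend (g t0) y) ->
  exists f : R -> R, [/\ real_analytic_at f t0, f t0 = y &
    \forall t \near t0, Z (extend (g t) (f t))].

(** As long as the number of points in the fibre is constant, the local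
    continuations of the points of one fibre exhaust the fibres nearby and keep
    their order. *)
Lemma nth_fibre_analytic s Z (g : R -> 'rV[R]_n) (t0 : R) m j :
  enumerates s Z -> arc_continuable Z ->
  (forall i, real_analytic_at (fun t => g t ord0 i) t0) ->
  (\forall t \near t0, size (s (g t)) = m) -> (j < m)%N ->
  real_analytic_at (fun t => nth 0 (s (g t)) j) t0.
Proof.
move=> sZ cZ ga gm jm.
have m0 : size (s (g t0)) = m by exact: nbhs_singleton gm.
have loc i : exists f : R -> R, (i < m)%N ->
    [/\ real_analytic_at f t0, f t0 = nth 0 (s (g t0)) i &
      \forall t \near t0, Z (extend (g t) (f t))].
  case: (ltnP i m) => im; last by exists (fun=> 0).
  have [_ /(_ (nth 0 (s (g t0)) i)) [_]] := sZ (g t0).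
  rewrite mem_nth ?m0 // => /(_ isT) /(cZ _ _ _ ga)[f hf].
  by exists f.
have {loc}[F FP] := choice loc.
have near_all (P : nat -> R -> Prop) : (forall i, (i < m)%N -> \forall t \near t0, P i t) ->
    \forall t \near t0, forall i, (i < m)%N -> P i t.
  elim: m {gm jm m0 FP} => [|m IH] hP; first by apply: filterE.
  have := IH (fun i im => hP i (ltnW im)); have := hP m (ltnSn m).
  apply: filterS2 => t Pm Pi i; rewrite ltnS leq_eqVlt => /orP[/eqP -> //|].
  exact: Pi.
have inZ := near_all _ (fun i im => let: And3 _ _ h := FP i im in h).
have lt : \forall t \near t0, forall i, (i < m)%N -> (i.+1 < m)%N -> F i t < F i.+1 t.
  apply: near_all => i im; case: (ltnP i.+1 m) => im1; last by apply: filterE.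
  have [fa f0 _] := FP i im; have [fa1 f01 _] := FP i.+1 im1.
  have dc : F i.+1 t + -1 * F i t @[t --> t0] --> F i.+1 t0 + -1 * F i t0.
    apply: (@real_analytic_continuous _ (fun t => F i.+1 t + -1 * F i t)).
    by apply: real_analyticD => //; apply: real_analyticM => //; exact: real_analytic_cst.
  have d0 : 0 < F i.+1 t0 + -1 * F i t0.
    rewrite f0 f01 mulN1r subr_gt0; have [ss _] := sZ (g t0).
    by apply: (sorted_ltn_nth lt_trans) => //; rewrite inE m0.
  apply: filterS (cvgr_gt _ dc _ d0) => t; rewrite mulN1r subr_gt0 => + _ //.
have [fa f0 _] := FP j jm; apply: real_analytic_near_eq fa.
apply: filterS3 gm inZ lt => t gm inZ lt.
have [ss sE] := sZ (g t).
suff -> : s (g t) = mkseq (F^~ t) m by rewrite nth_mkseq.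
have sm : sorted <%R (mkseq (F^~ t) m).
  apply/(sortedP 0) => i; rewrite size_mkseq => im.
  by rewrite !nth_mkseq ?lt // ltnW.
apply: (lt_sorted_eq ss sm) => y; apply/esym.
have um := lt_sorted_uniq sm.
have sub : {subset mkseq (F^~ t) m <= s (g t)}.
  by move=> z /mapP[i]; rewrite mem_iota /= add0n => im ->; apply/sE; exact: inZ.
by have [_ ->] := uniq_min_size um sub (eq_leq (etrans gm (esym (size_mkseq _ m)))).
Qed.
End Fibres.

(** * Simple roots of polynomials depending on parameters *)
Section UnivariateRoots.
Local Open Scope ring_scope.
Context {R : realType}.
Implicit Types (P : {poly R}) (y : R).

Definition simple_root P y := (P.[y] == 0) && (P^`().[y] != 0).

(** Take for [k.+1] the least order of a derivative that does not vanish at [y],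
    that is, the multiplicity of [y]. *)
Lemma root_simple_root_derivn P y : P != 0 -> P.[y] = 0 ->
  exists2 k, (k < size P)%N & simple_root (P^`(k)) y.
Proof.
move=> P0 Py.
have ex : exists k, (P^`(k)).[y] != 0.
  exists (size P).-1.
  have -> : P^`((size P).-1) = (lead_coef P *+ (size P).-1`!)%:P.
    apply/polyP => -[|i]; rewrite coef_derivn coefC /=.
      by rewrite addn0 ffactnn.
    rewrite nth_default ?mul0rn // addnS.
    by rewrite (leq_trans (leqSpred _)) // ltnS leq_addr.
  by rewrite hornerC mulrn_eq0 negb_or lead_coef_eq0 P0 andbT -lt0n fact_gt0.
case: (ex_minnP ex) => -[|k] Pk kmin; first by rewrite derivn0 Py eqxx in Pk.
have Pk0 : (P^`(k)).[y] == 0.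
  by apply/negPn/negP => /kmin; rewrite ltnn.
exists k; last by rewrite /simple_root Pk0 -derivnS.
rewrite ltnNge; apply/negP => kP.
by move: Pk; rewrite derivn_poly0 ?horner0 ?eqxx // (leq_trans kP).
Qed.

Lemma sgr_horner_const P (y z : R) : y <= z ->
  (forall w, y <= w <= z -> P.[w] != 0) -> Num.sg P.[y] = Num.sg P.[z].
Proof.
move=> yz nr; have Py := nr y; have Pz := nr z; rewrite !lexx yz in Py Pz.
move: (Py isT) (Pz isT) => {}Py {}Pz.
have ivt (Q : {poly R}) : (forall w, y <= w <= z -> Q.[w] != 0) ->
    Q.[y] < 0 -> Q.[z] < 0.
  move=> nQ Qy; rewrite ltNge; apply/negP => Qz.
  have [|w wI /rootP Qw] := @poly_ivt R Q y z yz; first by rewrite ltW.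
  by move: (nQ w wI); rewrite Qw eqxx.
case: (ltgtP P.[y] 0) Py => // Py _; first by rewrite !ltr0_sg // (ivt P).
rewrite !gtr0_sg // -oppr_lt0 -hornerN; apply: ivt => [w|].
  by rewrite hornerN oppr_eq0; exact: nr.
by rewrite hornerN oppr_lt0.
Qed.
Lemma eq_sgr (a b : R) : Num.sg a = Num.sg b -> (a = 0 <-> b = 0) /\ (0 < a <-> 0 < b).
Proof.
move=> e; split; last by rewrite -(sgr_gt0 a) e sgr_gt0.
split=> z0; apply/eqP; first by rewrite -(sgr_eq0 b) -e z0 sgr0.
by rewrite -(sgr_eq0 a) e z0 sgr0.
Qed.
End UnivariateRoots.

Section ParametrizedRoots.
Local Open Scope classical_set_scope.
Local Open Scope ring_scope.
Context {R : realType} {n : nat}.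
Implicit Types (x : 'rV[R]_n) (p : mpoly n.+1 R) (q : {poly (mpoly n R)}).

Definition specialize x q : {poly R} := map_poly (meval (fun i => x ord0 i)) q.

Definition poly_in_last_var p : {poly (mpoly n R)} :=
  \sum_(m <- msupp p) (mpolyC n (mcoeff m p))%:P *
    \prod_(i < n.+1) (if unlift ord_max i is Some j then (mpolyX R (mnm1 j))%:P
                      else 'X) ^+ m i.

Lemma specialize_poly_in_last_var x y p :
  (specialize x (poly_in_last_var p)).[y] = poly_at (extend x y) p.
Proof.
rewrite /specialize /poly_in_last_var /poly_at mevalE rmorph_sum /= horner_sum.
apply: eq_bigr => m _; rewrite rmorphM /= map_polyC /= mevalC hornerM hornerC.
congr (_ * _); rewrite rmorph_prod /= horner_prod; apply: eq_bigr => i _.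
rewrite rmorphXn /= horner_exp mxE; congr (_ ^+ _).
case: unliftP => [j _|_]; last by rewrite map_polyX hornerX.
by rewrite map_polyC /= mevalXU hornerC.
Qed.

Lemma size_specialize x q : (size (specialize x q) <= size q)%N.
Proof. exact: size_poly. Qed.

Lemma deriv_specialize x q k : (specialize x q)^`(k) = specialize x (q^`(k)).
Proof. exact: derivn_map. Qed.

Lemma deriv1_specialize x q : (specialize x q)^`() = specialize x q^`().
Proof. exact: (deriv_specialize x q 1). Qed.

Lemma poly_at_analytic (p : mpoly n R) (g : R -> 'rV[R]_n) (t0 : R) :
  (forall i, real_analytic_at (fun t => g t ord0 i) t0) ->
  real_analytic_at (fun t => poly_at (g t) p) t0.
Proof.
move=> ga; rewrite (_ : (fun t => _) = fun t => \sum_(m <- msupp p)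
    (mcoeff m p * \prod_i g t ord0 i ^+ m i)); last first.
  by apply/funext => t; rewrite /poly_at mevalE.
apply: real_analytic_sum => m; apply: real_analyticM; first exact: real_analytic_cst.
by apply: real_analytic_prod => i; exact: real_analyticX.
Qed.

Lemma specialize_horner_analytic q (g : R -> 'rV[R]_n) (f : R -> R) (t0 : R) :
  (forall i, real_analytic_at (fun t => g t ord0 i) t0) -> real_analytic_at f t0 ->
  real_analytic_at (fun t => (specialize (g t) q).[f t]) t0.
Proof.
move=> ga fa; rewrite (_ : (fun t => _) = fun t => \sum_(i < size q)
    poly_at (g t) q`_i * f t ^+ i); last first.
  by apply/funext => t; rewrite /specialize /map_poly horner_poly.
apply: real_analytic_sum => i; apply: real_analyticM; first exact: poly_at_analytic.
exact: real_analyticX.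
Qed.

Definition simple_roots (Q : seq {poly (mpoly n R)}) : set 'rV[R]_n.+1 :=
  [set v | exists2 q, q \in Q & simple_root (specialize (base v) q) (height v)].

Lemma semialgebraic_simple_roots Q : semialgebraic (simple_roots Q).
Proof.
apply: semialgebraic_bigcup => q _; apply: definable_semialgebraic.
have tq q' : polynomial_term (fun e =>
    (specialize (env_point n e) q').[nth 0 e n]).
  rewrite (_ : (fun e => _) = fun e => \sum_(i < size q')
      poly_at (env_point n e) q'`_i * nth 0 e n ^+ i); last first.
    by apply/funext => e; rewrite /specialize /map_poly horner_poly.
  apply: polynomial_term_sum => i; apply: polynomial_termM.
    exact: polynomial_term_poly_at.
  exact/polynomial_termX/polynomial_term_var.
have d0 := @polynomial_term_const R 0.
have := definable_and (definable_eq (tq q) d0)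
  (definable_not (definable_eq (tq q^`()) d0)).
apply: definable_ext => e; rewrite env_pointS extendK height_extend /simple_root.
rewrite deriv1_specialize.
by split=> [[/eqP -> /eqP]|/andP[/eqP -> /eqP]].
Qed.

(** Analytic continuation of a simple root, by the implicit function theorem
    applied to the Taylor expansion of the polynomial at the root. *)
Lemma simple_roots_continuable Q : arc_continuable (simple_roots Q).
Proof.
move=> g t0 y ga [q qQ]; rewrite extendK height_extend => /andP[/eqP y0 y1].
pose D := size q.
pose b d t := (specialize (g t) q)^`N(d).[y].
have ba d : real_analytic_at (b d) t0.
  rewrite (_ : b d = fun t => \sum_(i < D)
      (poly_at (g t) q`_(d + i) * ('C(d + i, d)%:R * y ^+ i))); last first.
    apply/funext => t; rewrite /b (@horner_coef_wide _ D); last first.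
      apply/leq_sizeP => i Di; rewrite coef_nderivn nth_default ?mul0rn //.
      by apply: leq_trans (size_specialize _ _) (leq_trans Di (leq_addl _ _)).
    apply: eq_bigr => i _; rewrite coef_nderivn coef_map /= mulrA; congr (_ * _).
    by rewrite mulr_natr.
  apply: real_analytic_sum => i; apply: real_analyticM; last exact: real_analytic_cst.
  exact: poly_at_analytic.
have [||u [ua u0 uf]] := real_analytic_implicit D ba.
- by rewrite /b poly.nderivn0.
- by rewrite /b poly.nderivn1.
have fa : real_analytic_at (fun t => y + u t) t0.
  by apply: real_analyticD => //; exact: real_analytic_cst.
exists (fun t => y + u t); split=> //; first by rewrite u0 addr0.
have := real_analytic_continuous (specialize_horner_analytic q^`() ga fa).
rewrite u0 addr0 => dc.
have dq t : specialize (g t) q^`() = (specialize (g t) q)^`().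
  by rewrite deriv1_specialize.
have dn : \forall t \near t0, (specialize (g t) q)^`().[y + u t] != 0.
  move: y1; rewrite -dq neq_lt => /orP[h|h].
    by apply: filterS (cvgr_lt _ dc _ h) => t; rewrite dq neq_lt => ->.
  by apply: filterS (cvgr_gt _ dc _ h) => t; rewrite dq neq_lt orbC => ->.
apply: filterS2 uf dn => t ut dt; exists q => //.
rewrite extendK height_extend /simple_root dt andbT.
rewrite (@nderiv_taylor_wide _ D.+2) ?ut //; first exact: mulrC.
by apply: leq_trans (size_specialize _ _) _; rewrite -addn2 leq_addr.
Qed.

Lemma simple_roots_enumerates Q : exists s : 'rV[R]_n -> seq R,
  enumerates s (simple_roots Q) /\
  forall x, (size (s x) <= \sum_(q <- Q) size q)%N.
Proof.
pose r x := [seq y <- flatten [seq undup (polyrcf.rootsR (specialize x q)) | q <- Q]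
            | has (fun q => simple_root (specialize x q) y) Q].
exists (fun x => sort <=%R (undup (r x))); split=> [x|x].
  split; first by rewrite sort_lt_sorted undup_uniq.
  move=> y; rewrite mem_sort mem_undup mem_filter /simple_roots /= extendK height_extend.
  split=> [[q qQ yq]|/andP[/hasP[q qQ yq] _]]; last by exists q.
  apply/andP; split; first by apply/hasP; exists q.
  apply/flattenP; exists (undup (polyrcf.rootsR (specialize x q))).
    by apply/mapP; exists q.
  rewrite mem_undup.
  have q0 : specialize x q != 0.
    by apply: contraTneq yq => ->; rewrite /simple_root deriv0 horner0 eqxx andbF.
  have := polyrcf.roots_on_rootsR q0 y; rewrite inE /= => <-.
  by case/andP: yq => /eqP yq _; apply/rootP.
rewrite size_sort; apply: leq_trans (size_undup _) _.
rewrite size_filter; apply: leq_trans (count_size _ _) _.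
rewrite size_flatten /shape -map_comp sumnE big_map.
apply: leq_sum => q _ /=; apply: leq_trans (size_specialize x q).
have [->|q0] := eqVneq (specialize x q) 0; first by rewrite polyrcf.rootsR0.
apply: ltnW; apply: max_poly_roots (undup_uniq _) => //.
apply/allP => y; rewrite mem_undup => yr.
by have := polyrcf.roots_on_rootsR q0 y; rewrite yr => /andP[].
Qed.

(** All roots of the polynomials of [ps] that are not identically zero on the
    fibre are simple roots of one of these derivatives. *)
Definition derivatives (ps : seq (mpoly n.+1 R)) : seq {poly (mpoly n R)} :=
  [seq (poly_in_last_var p)^`(k) | p <- ps, k <- iota 0 (size (poly_in_last_var p))].

Lemma sgr_between_simple_roots ps p x (y z : R) : p \in ps -> y <= z ->
  (forall w, y <= w <= z -> ~ simple_roots (derivatives ps) (extend x w)) ->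
  Num.sg (poly_at (extend x y) p) = Num.sg (poly_at (extend x z) p).
Proof.
move=> pps yz nZ; rewrite -!specialize_poly_in_last_var.
have [->|P0] := eqVneq (specialize x (poly_in_last_var p)) 0; first by rewrite !horner0.
apply: sgr_horner_const => // w wI; apply/negP => /eqP Pw.
have [k kP] := root_simple_root_derivn P0 Pw.
rewrite deriv_specialize => sk; apply: (nZ w wI).
exists ((poly_in_last_var p)^`(k)); last by rewrite extendK height_extend.
apply/allpairsPdep; exists p, k; split=> //.
by rewrite mem_iota /= (leq_trans kP) // size_specialize.
Qed.

(** The signs of the polynomials that define [S] are constant on an interval of a
    fibre free of simple roots of their derivatives. *)
Lemma semialgebraic_breakpoints (S : set 'rV[R]_n.+1) : semialgebraic S ->
  exists (Z : set 'rV[R]_n.+1) (s : 'rV[R]_n -> seq R) (N : nat),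
  [/\ semialgebraic Z, arc_continuable Z, enumerates s Z,
      forall x, (size (s x) <= N)%N &
      forall x (y z : R), y <= z ->
        (forall w, y <= w <= z -> ~ Z (extend x w)) ->
        S (extend x y) <-> S (extend x z)].
Proof.
move=> [l ->]; pose ps := flatten [seq b.1 ++ b.2 | b <- l].
have [s [sZ sN]] := simple_roots_enumerates (derivatives ps).
exists (simple_roots (derivatives ps)), s, (\sum_(q <- derivatives ps) size q)%N.
split=> //; first exact: semialgebraic_simple_roots.
  exact: simple_roots_continuable.
move=> x y z yz nZ; have sg p (pp : p \in ps) := sgr_between_simple_roots pp yz nZ.
have hb b : b \in l -> basic_semialgebraic b.1 b.2 (extend x y) <->
    basic_semialgebraic b.1 b.2 (extend x z).
  move=> bl.
  have bp p : p \in b.1 ++ b.2 -> p \in ps.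
    by move=> pb; apply/flattenP; exists (b.1 ++ b.2) => //; apply/mapP; exists b.
  have e0 p : p \in b.1 -> poly_at (extend x y) p = 0 <-> poly_at (extend x z) p = 0.
    move=> pb; have pp : p \in b.1 ++ b.2 by rewrite mem_cat pb.
    exact: (eq_sgr (sg p (bp p pp))).1.
  have e1 p : p \in b.2 -> 0 < poly_at (extend x y) p <-> 0 < poly_at (extend x z) p.
    move=> pb; have pp : p \in b.1 ++ b.2 by rewrite mem_cat pb orbT.
    exact: (eq_sgr (sg p (bp p pp))).2.
  by split=> -[h0 h1]; split=> p pb; [apply/e0/h0|apply/e1/h1|apply/e0/h0|apply/e1/h1].
by split=> -[b bl /(hb b bl) ?]; exists b.
Qed.
End ParametrizedRoots.

(** * Arc-symmetric sets *)
Section ArcSymmetry.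
Local Open Scope classical_set_scope.
Local Open Scope ring_scope.
Context {R : realType} {n : nat}.
Implicit Types (S E : set 'rV[R]_n) (g : R -> 'rV[R]_n).

Lemma analytic_arc_affine S g (p q : R) :
  (forall t, -1 < t < 1 -> -1 < p + q * t < 1) ->
  analytic_arc S g -> analytic_arc S (fun t => g (p + q * t)).
Proof.
move=> pq [gS ga]; split=> [t|t]; rewrite in_itv /= => /pq tI.
  by apply: gS; rewrite in_itv.
move=> i; apply: (@real_analytic_affine _ (fun t => g t ord0 i)).
by apply: ga; rewrite in_itv.
Qed.

(** The supremum of the parameters up to which the arc stays in [E] can always be
    passed by rescaling the arc around it. *)
Lemma arc_symmetric_extend_right S E g (a b : R) :
  arc_symmetric S E -> analytic_arc S g -> -1 <= a -> a < b -> b <= 1 ->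
  (forall t, a < t < b -> E (g t)) -> forall t, a < t < 1 -> E (g t).
Proof.
move=> sE gS a1 ab b1 gE.
pose A := [set c : R | c <= 1 /\ forall t, a < t < c -> E (g t)].
have Ab : A b by [].
have hsA : has_sup A by split; [exists b|exists 1 => c []].
pose c := sup A.
have bc : b <= c by apply: ub_le_sup => //; exact: hsA.2.
have c1 : c <= 1 by apply: ge_sup; [exists b|move=> ? []].
have cE t : a < t < c -> E (g t).
  move=> /andP[at_ tc].
  have [d [_ dE] td] := sup_gt hsA.1 tc.
  by apply: dE; rewrite at_.
have [c1'|c1'] := ltP c 1; last first.
  by move=> t /andP[at_ t1]; apply: cE; rewrite at_ (lt_le_trans t1).
pose d := Num.min (c - a) (1 - c).
have d0 : 0 < d by rewrite lt_min !subr_gt0 (lt_le_trans ab bc).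
have dca : d <= c - a by rewrite ge_min lexx.
have dc1 : d <= 1 - c by rewrite ge_min lexx orbT.
have hI t : -1 < t < 1 -> -1 < c + d * t < 1 by nra.
have := sE _ (analytic_arc_affine hI gS) => /(_ _) hE.
have {}hE t : -1 < t < 1 -> E (g (c + d * t)).
  move=> tI; apply: hE; last by rewrite in_itv.
  by move=> u; rewrite in_itv /= => uI; apply: cE; nra.
have : A (c + d).
  split; first by lra.
  move=> t /andP[at_ tcd]; have [tc|tc] := ltP t c; first by apply: cE; rewrite at_.
  have -> : t = c + d * ((t - c) / d) by rewrite mulrC divfK ?gt_eqF //; ring.
  apply: hE; rewrite ltr_pdivlMr // ltr_pdivrMr //; lra.
move=> /(ub_le_sup hsA.2); rewrite -/c; lra.
Qed.

Lemma arc_symmetric_extend S E g (a b : R) :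
  arc_symmetric S E -> analytic_arc S g -> -1 <= a -> a < b -> b <= 1 ->
  (forall t, a < t < b -> E (g t)) -> forall t, -1 < t < 1 -> E (g t).
Proof.
move=> sE gS a1 ab b1 gE.
have gE1 := arc_symmetric_extend_right sE gS a1 ab b1 gE.
have hI (t : R) : -1 < t < 1 -> -1 < 0 + -1 * t < 1 by lra.
have gS' := analytic_arc_affine hI gS.
have := arc_symmetric_extend_right sE gS' (a := -1) (b := - a) => /(_ _ _ _ _) h t tI.
rewrite (_ : t = 0 + -1 * (- t)); last by ring.
by apply: h; try lra; move=> u uI; apply: gE1; lra.
Qed.

Lemma near_right_itv (P : R -> Prop) (a b : R) : a < b ->
  (\forall t \near a^'+, P t) ->
  exists c, [/\ a < c, c <= b & forall t, a < t < c -> P t].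
Proof.
move=> ab; rewrite near_withinE => /nbhs_ballP[e /= e0 eP].
exists (Num.min b (a + e)); rewrite lt_min ab ltrDl ge_min lexx; split=> // t.
rewrite lt_min => /and3P[at_ tb tae]; apply: eP => //.
by rewrite /ball /= distrC gtr0_norm ?subr_gt0 // ltrBlDl.
Qed.

Definition decided_right (t0 : R) (P : R -> Prop) :=
  (\forall t \near t0^'+, P t) \/ (\forall t \near t0^'+, ~ P t).

Lemma decided_right_and t0 (P Q : R -> Prop) : decided_right t0 P -> decided_right t0 Q ->
  decided_right t0 (fun t => P t /\ Q t).
Proof.
move=> [hP|hP] hQ; last by right; apply: filterS hP => t nP [].
case: hQ => hQ; [left|right]; apply: filterS2 hP hQ => t; tauto.
Qed.

Lemma decided_right_not t0 (P : R -> Prop) : decided_right t0 P ->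
  decided_right t0 (fun t => ~ P t).
Proof. by move=> [hP|hP]; [right|left] => //; apply: filterS hP => t Pt /(_ Pt). Qed.

Lemma decided_right_ext t0 (P Q : R -> Prop) : (forall t, P t <-> Q t) ->
  decided_right t0 P -> decided_right t0 Q.
Proof.
by move=> PQ [hP|hP]; [left|right]; apply: filterS hP => t; rewrite PQ.
Qed.

Lemma decided_right_all (I : eqType) (s : seq I) (t0 : R) (P : I -> R -> Prop) :
  (forall i, decided_right t0 (P i)) ->
  decided_right t0 (fun t => forall i, i \in s -> P i t).
Proof.
move=> hP; elim: s => [|i s IH]; first by left; apply: filterE.
apply: decided_right_ext (decided_right_and (hP i) IH) => t; split.
  by move=> [Pi Ps] j; rewrite inE => /orP[/eqP -> //|]; exact: Ps.
by move=> Ps; split=> [|j js]; apply: Ps; rewrite inE ?eqxx ?js ?orbT.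
Qed.

(** Along the arc each of the defining polynomials has, on the right of [t0], the
    constant sign given by [real_analytic_sign]. *)
Lemma semialgebraic_decided_right E g (t0 : R) : semialgebraic E ->
  (forall i, real_analytic_at (fun t => g t ord0 i) t0) ->
  decided_right t0 (fun t => E (g t)).
Proof.
move=> [s ->] ga.
have hb b : decided_right t0 (fun t => basic_semialgebraic b.1 b.2 (g t)).
  apply: decided_right_and; apply: decided_right_all => p.
    case: (real_analytic_sign (poly_at_analytic p ga)) => h; [left|right|right] => //.
      by apply: filterS h => t; lra.
    by apply: filterS h => t; lra.
  case: (real_analytic_sign (poly_at_analytic p ga)) => h; [right|left|right] => //.
    by apply: filterS h => t ->; rewrite ltxx.
  by apply: filterS h => t h1 h2; have := lt_trans h1 h2; rewrite ltxx.
have := decided_right_not (decided_right_all s (fun b => decided_right_not (hb b))).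
apply: decided_right_ext => t; split=> [h|[b bs bt] h]; last exact: h bt.
by apply: contrapT => nb; apply: h => b bs bt; apply: nb; exists b.
Qed.

(** One of the two sets contains the arc just to the right of a point of the
    negative half, hence contains all of it. *)
Lemma arc_symmetricU S E E' : semialgebraic E ->
  arc_symmetric S E -> arc_symmetric S E' -> arc_symmetric S (E `|` E').
Proof.
move=> saE sE sE' g gS gE.
have m2 : -1 < - 2^-1 :> R by lra.
have ga i : real_analytic_at (fun t => g t ord0 i) (- 2^-1).
  by apply: gS.2; rewrite in_itv /=; apply/andP; split; lra.
have l0 : - 2^-1 < 0 :> R by lra.
case: (semialgebraic_decided_right saE ga) => /(near_right_itv l0)[c [c1 c0 h]] t;
  rewrite in_itv /= => tI; [left|right].
  by apply: (arc_symmetric_extend sE gS _ c1 _ h) tI; lra.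
apply: (arc_symmetric_extend sE' gS _ c1 _ _) tI; [lra|lra|] => u uI.
have [|Eu|//] := gE u; last by case: (h u uI).
by rewrite in_itv /=; lra.
Qed.

Lemma arc_symmetricS S S' E : S' `<=` S -> arc_symmetric S E ->
  arc_symmetric S' (E `&` S').
Proof.
move=> S'S sE g [gS' ga] gE t tI; split; last exact: gS'.
by apply: sE tI => [|u /gE[]//]; split=> // u /gS' /S'S.
Qed.

(** The chain lives in an arbitrary ambient set [S], because the proof replaces
    the ambient set by pieces of the members of the chain. *)
Definition arc_noetherian S := forall E : nat -> set 'rV[R]_n,
  (forall k, semialgebraic (E k)) -> (forall k, E k `<=` S) ->
  (forall k, arc_symmetric S (E k)) -> (forall k, E k.+1 `<=` E k) ->
  exists N, forall k, (N <= k)%N -> E k = E N.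

Lemma descending_le (E : nat -> set 'rV[R]_n) : (forall k, E k.+1 `<=` E k) ->
  forall i j, (i <= j)%N -> E j `<=` E i.
Proof.
by move=> dE i j /subnK <-; elim: (j - i)%N => // k IH x /dE /IH.
Qed.

(** On each of finitely many pieces the chain of traces is eventually constant. *)
Lemma arc_noetherian_cover (I : eqType) (l : seq I) (C : I -> set 'rV[R]_n) S :
  (forall i, i \in l -> [/\ semialgebraic (C i), C i `<=` S & arc_noetherian (C i)]) ->
  S `<=` [set x | exists2 i, i \in l & C i x] -> arc_noetherian S.
Proof.
move=> lC lS E saE ES sE dE.
have [N NP] : exists N, forall i, i \in l -> forall k, (N <= k)%N ->
    E k `&` C i = E N `&` C i.
  elim: l lC {lS} => [|i l IH] lC; first by exists 0%N.
  have [|N NP] := IH; first by move=> j jl; apply: lC; rewrite inE jl orbT.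
  have [saC CS nC] := lC i (mem_head _ _).
  have [||||M MP] := nC (fun k => E k `&` C i).
  - by move=> k; exact: semialgebraicI.
  - by move=> k; exact: subIsetr.
  - by move=> k; exact: arc_symmetricS (sE k).
  - by move=> k; exact: setSI.
  exists (maxn N M) => j; rewrite inE => /orP[/eqP ->|jl] k; rewrite geq_max => /andP[Nk Mk].
    by rewrite MP // [RHS]MP // leq_maxr.
  by rewrite NP // [RHS]NP // leq_maxl.
exists N => k Nk; apply/seteqP; split; first exact: descending_le.
move=> x Ex; have [i il Cx] := lS x (ES _ x Ex).
by have [] : (E k `&` C i) x by rewrite (NP i il k Nk).
Qed.
End ArcSymmetry.

(** * Cells *)
Section Cells.
Local Open Scope classical_set_scope.
Local Open Scope ring_scope.
Context {R : realType} {n : nat}.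
Implicit Types (x : 'rV[R]_n) (D E S : set 'rV[R]_n.+1) (y : R).

Definition shadow D : set 'rV[R]_n := [set x | exists y, D (extend x y)].

Definition lifts_arcs D := forall g, analytic_arc (shadow D) g ->
  forall t0 y, t0 \in `](-1), 1[ -> D (extend (g t0) y) ->
  exists f : R -> R, f t0 = y /\
    forall t, t \in `](-1), 1[ -> real_analytic_at f t /\ D (extend (g t) (f t)).

Definition graph_like D :=
  forall x y z, D (extend x y) -> D (extend x z) -> y = z.

Definition band_like D :=
  (forall x y z w, D (extend x y) -> D (extend x z) -> y < w < z -> D (extend x w)) /\
  (forall x y, D (extend x y) ->
    exists a b, [/\ a < y < b, D (extend x a) & D (extend x b)]).

(** Weaker than the cells of a cylindrical decomposition: the shadow can be any
    semialgebraic set, since the induction is on the number of variables. *)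
Definition cell D :=
  [/\ semialgebraic D, lifts_arcs D & graph_like D \/ band_like D].

Lemma analytic_arc_extend S (g : R -> 'rV[R]_n) (f : R -> R) :
  (forall t, t \in `](-1), 1[ -> forall i, real_analytic_at (fun u => g u ord0 i) t) ->
  (forall t, t \in `](-1), 1[ -> real_analytic_at f t /\ S (extend (g t) (f t))) ->
  analytic_arc S (fun t => extend (g t) (f t)).
Proof.
move=> ga fS; split=> t tI; first by have [] := fS t tI.
move=> i; case: (unliftP ord_max i) => [j ->|->].
  rewrite (_ : (fun u => _) = fun u => g u ord0 j); first exact: ga.
  by apply/funext => u; rewrite mxE liftK.
rewrite (_ : (fun u => _) = f); first by have [] := fS t tI.
by apply/funext => u; rewrite mxE unlift_none.
Qed.

Definition full_fibres D E : set 'rV[R]_n :=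
  shadow D `&` [set x | forall y, D (extend x y) -> E (extend x y)].

Lemma semialgebraic_full_fibres D E : semialgebraic D -> semialgebraic E ->
  semialgebraic (full_fibres D E).
Proof.
move=> sD sE; apply: semialgebraicI; first exact: semialgebraic_proj.
exact: semialgebraic_forall_fibre.
Qed.

(** A point of the fibre over an arc lies on a lift of the arc, which is in [E] for
    negative parameters. *)
Lemma full_fibres_arc_symmetric D E : lifts_arcs D -> arc_symmetric D E ->
  arc_symmetric (shadow D) (full_fibres D E).
Proof.
move=> lD sE g gD gE t tI; split; first exact: gD.1.
move=> y Dy; have [f [fy fD]] := lD g gD t y tI Dy.
have fa := analytic_arc_extend gD.2 fD.
rewrite -fy; apply: (sE _ fa) tI => u uI; apply: (gE u uI).2.
by apply: (fD u _).2; move: uI; rewrite !in_itv /=; lra.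
Qed.

(** The sets over which the members of a chain fill whole fibres form a chain in
    one dimension less. *)
Lemma full_fibres_stabilize D (E : nat -> set 'rV[R]_n.+1) :
  (forall B : set 'rV[R]_n, semialgebraic B -> arc_noetherian B) -> cell D ->
  (forall k, semialgebraic (E k)) -> (forall k, arc_symmetric D (E k)) ->
  (forall k, E k.+1 `<=` E k) ->
  exists N, forall k, (N <= k)%N -> full_fibres D (E k) = full_fibres D (E N).
Proof.
move=> IH [saD lD _] saE sE dE.
apply: (IH _ (semialgebraic_proj saD)) => k.
- exact: semialgebraic_full_fibres.
- exact: subIsetl.
- exact: full_fibres_arc_symmetric.
- by move=> x [Dx hx]; split=> // y /hx /dE.
Qed.

Lemma arc_noetherian_graph D :
  (forall B : set 'rV[R]_n, semialgebraic B -> arc_noetherian B) ->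
  cell D -> graph_like D -> arc_noetherian D.
Proof.
move=> IH cD gD E saE ED sE dE.
have [N NP] := full_fibres_stabilize IH cD saE sE dE.
exists N => k Nk; apply/seteqP; split; first exact: descending_le.
move=> v; rewrite -(extend_base v) => Ev.
have : full_fibres D (E N) (base v).
  split; first by exists (height v); exact: ED Ev.
  by move=> y /gD /(_ (ED _ _ Ev)) ->.
by rewrite -(NP k Nk) => -[_]; apply; exact: ED Ev.
Qed.

(** Along a fibre of a band the vertical segments are arcs. *)
Lemma full_fibre_of_interval D E x a b : band_like D -> arc_symmetric D E -> a < b ->
  (forall y, a < y < b -> D (extend x y) /\ E (extend x y)) ->
  forall z, D (extend x z) -> E (extend x z).
Proof.
move=> [cD oD] sE ab abE z Dz.
pose w := (a + b) / 2.
have wab : a < w < b by rewrite /w; lra.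
have [Dw _] := abE w wab.
have [a' [b' [wz Da Db]]] : exists a' b', [/\ [&& a' < z, a' < w, z < b' & w < b'],
    D (extend x a') & D (extend x b')].
  have [a1 [b1 [/andP[az zb] Da1 Db1]]] := oD x z Dz.
  have [a2 [b2 [/andP[aw wb] Da2 Db2]]] := oD x w Dw.
  exists (Num.min a1 a2), (Num.max b1 b2).
  rewrite !gt_min !lt_max az aw zb wb !orbT; split=> //.
    by rewrite minElt; case: ifP.
  by rewrite maxElt; case: ifP.
have /and4P[az aw zb wb] := wz.
(* The segment of the fibre between [a'] and [b'], parametrized by ]-1, 1[; the
   map [r] below is the inverse parametrization. *)
pose p := (a' + b') / 2; pose q := (b' - a') / 2.
have q0 : 0 < q by rewrite /q; lra.
have arc : analytic_arc D (fun t => extend x (p + q * t)).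
  apply: (@analytic_arc_extend D (fun=> x) (fun t => p + q * t)) => [t _ i|t].
    exact: real_analytic_cst.
  rewrite in_itv /= => /andP[t0 t1]; split; last first.
    by apply: (cD x a' b') => //; rewrite /p; move: (q0); rewrite /q => qp; nra.
  apply: real_analyticD; first exact: real_analytic_cst.
  by apply: real_analyticM; [exact: real_analytic_cst|exact: real_analytic_id].
pose r u := (u - p) / q.
have rK u : p + q * r u = u by rewrite /r mulrC divfK ?gt_eqF //; ring.
have rlt u v : (r u < r v) = (u < v).
  by rewrite /r ltr_pM2r ?invr_gt0 // ltrD2r.
have ra : r a' = -1 by rewrite /r /p /q; field; rewrite subr_eq0 gt_eqF //; lra.
have rb : r b' = 1 by rewrite /r /p /q; field; rewrite subr_eq0 gt_eqF //; lra.
rewrite -(rK z).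
apply: (@arc_symmetric_extend _ _ _ _ _ (r (Num.max a a')) (r (Num.min b b')) sE arc).
- by rewrite -ra leNgt rlt -leNgt le_max lexx orbT.
- by rewrite rlt lt_min !gt_max; apply/andP; split; apply/andP; split; lra.
- by rewrite -rb leNgt rlt -leNgt ge_min lexx orbT.
- move=> t /andP[t0 t1]; have [] // := abE (p + q * t).
  have tE : t = r (p + q * t) by rewrite /r addrAC subrr add0r mulrC mulKf ?gt_eqF.
  by move: t0 t1; rewrite tE !rlt -tE gt_max lt_min => /andP[-> _] /andP[-> _].
- by rewrite -ra -rb !rlt az zb.
Qed.
End Cells.

(** * Decomposition of a semialgebraic set into cells *)
Section CellDecomposition.
Local Open Scope classical_set_scope.
Local Open Scope ring_scope.
Context {R : realType} {n : nat}.
Implicit Types (x : 'rV[R]_n) (Z S : set 'rV[R]_n.+1) (y z : R) (l : seq R).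

(** The [j]-th of the open intervals cut out on the line by the entries of [l],
    the first and the last being unbounded. *)
Definition in_gap l j y :=
  ((0 < j)%N -> nth 0 l j.-1 < y) /\ ((j < size l)%N -> y < nth 0 l j).

Lemma in_gap_convex l j y z w : in_gap l j y -> in_gap l j z -> y <= w <= z -> in_gap l j w.
Proof.
move=> [y1 _] [_ z2] /andP[yw wz]; split=> h.
  exact: lt_le_trans (y1 h) yw.
exact: le_lt_trans wz (z2 h).
Qed.

Lemma in_gap_open l j y : in_gap l j y ->
  exists a b, [/\ a < y < b, in_gap l j a & in_gap l j b].
Proof.
move=> yg; have [y1 y2] := yg.
exists (if (0 < j)%N then (nth 0 l j.-1 + y) / 2 else y - 1).
exists (if (j < size l)%N then (y + nth 0 l j) / 2 else y + 1).
split.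
- apply/andP; split; case: ifP => h; last lra.
  + by have := y1 h; lra.
  + lra.
  + by have := y2 h; lra.
- split=> h; first by rewrite h; have := y1 h; lra.
  by have := y2 h; case: ifP => [/y1|_]; lra.
- split=> h; last by rewrite h; have := y2 h; lra.
  by have := y1 h; case: ifP => [/y2|_]; lra.
Qed.

Lemma in_gap_exists l y : y \notin l -> exists2 j, (j <= size l)%N & in_gap l j y.
Proof.
move=> yl; exists (find (fun z => y < z) l); first exact: find_size.
split=> h; last by apply: (nth_find 0 (a := fun z => y < z)); rewrite has_find.
set j := find _ _ in h *.
have jl : (j.-1 < size l)%N by rewrite prednK // find_size.
have /negbT : (y < nth 0 l j.-1) = false.
  by apply: (before_find 0 (a := fun z => y < z)); rewrite prednK.
rewrite -leNgt le_eqVlt => /orP[/eqP e|//].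
by move: yl; rewrite -e mem_nth.
Qed.

Lemma sorted_ltn_nthP l i j : sorted <%R l -> (j < size l)%N -> (i < j)%N ->
  nth 0 l i < nth 0 l j.
Proof.
by move=> sl jl ij; apply: (sorted_ltn_nth lt_trans) => //; rewrite inE // (ltn_trans ij).
Qed.

Lemma in_gap_notin l j y : (j <= size l)%N -> sorted <%R l -> in_gap l j y -> y \notin l.
Proof.
move=> jl sl [y1 y2]; apply/negP => /(nthP 0)[i il iy].
have [ij|ji] := ltnP i j.
  have j0 : (0 < j)%N by exact: leq_ltn_trans ij.
  have jl' : (j.-1 < size l)%N by rewrite prednK.
  have := y1 j0; rewrite -iy; move: ij; rewrite -{1}(prednK j0) ltnS leq_eqVlt.
  by case/orP=> [/eqP ->|ij]; [rewrite ltxx|rewrite ltNge ltW // sorted_ltn_nthP].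
have jl' := leq_ltn_trans ji il.
have := y2 jl'; rewrite -iy; move: ji; rewrite leq_eqVlt.
by case/orP=> [/eqP ->|ji]; [rewrite ltxx|rewrite ltNge ltW // sorted_ltn_nthP].
Qed.

Section Breakpoints.
Variables (Z S : set 'rV[R]_n.+1) (s : 'rV[R]_n -> seq R).
Hypotheses (sZ : enumerates s Z) (saZ : semialgebraic Z) (saS : semialgebraic S).

Definition break_graph j : set 'rV[R]_n.+1 :=
  [set v | (j < size (s (base v)))%N /\ height v = nth 0 (s (base v)) j].

(** Pieces are taken over the parameters with exactly [m] breakpoints: there the
    breakpoints are analytic along arcs. *)
Definition graph_piece m j : set 'rV[R]_n.+1 :=
  [set v | size (s (base v)) = m] `&` break_graph j `&` S.

Definition gap m j : set 'rV[R]_n.+1 :=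
  [set v | size (s (base v)) = m /\ in_gap (s (base v)) j (height v)].

Definition band_piece m j : set 'rV[R]_n.+1 :=
  gap m j `&`
  [set v | forall y, gap m j (extend (base v) y) -> S (extend (base v) y)].

Lemma semialgebraic_gap m j : (j <= m)%N -> semialgebraic (gap m j).
Proof.
move=> jm.
have saG i : semialgebraic (break_graph i) by exact: semialgebraic_nth_fibre sZ saZ.
have sam := semialgebraic_base (semialgebraic_size_fibre m sZ saZ).
have lo : semialgebraic [set v : 'rV[R]_n.+1 | (0 < j)%N -> above (break_graph j.-1) v].
  case: (j) => [|i]; first by apply: semialgebraic_ext semialgebraicT.
  by apply: semialgebraic_ext (semialgebraic_above (saG i)) => v /=; split=> // /(_ isT).
have up : semialgebraic [set v : 'rV[R]_n.+1 | (j < m)%N -> below (break_graph j) v].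
  case: (j < m)%N; last by apply: semialgebraic_ext semialgebraicT.
  by apply: semialgebraic_ext (semialgebraic_below (saG j)) => v /=; split=> // /(_ isT).
apply: semialgebraic_ext (semialgebraicI sam (semialgebraicI lo up)) => v.
rewrite /gap /in_gap /above /below /break_graph /setI /=.
split=> [[sm [h1 h2]]|[sm [h1 h2]]].
  split=> //; rewrite sm; split=> h.
    by have [y [yv]] := h1 h; rewrite extendK height_extend => -[_ <-].
  by have [y [yv]] := h2 h; rewrite extendK height_extend => -[_ <-].
split=> //; split=> h; eexists; rewrite extendK height_extend; split.
- exact: h1.
- by split=> //; rewrite sm prednK.
- by apply: h2; rewrite sm.
- by split=> //; rewrite sm.
Qed.

Lemma semialgebraic_band_piece m j : (j <= m)%N -> semialgebraic (band_piece m j).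
Proof.
move=> jm; have saG := semialgebraic_gap jm.
apply: semialgebraicI => //.
exact: semialgebraic_base (semialgebraic_forall_fibre saG saS).
Qed.

Lemma semialgebraic_graph_piece m j : semialgebraic (graph_piece m j).
Proof.
apply: semialgebraicI => //; apply: semialgebraicI.
  exact: semialgebraic_base (semialgebraic_size_fibre m sZ saZ).
exact: semialgebraic_nth_fibre sZ saZ.
Qed.

Hypothesis cZ : arc_continuable Z.

Lemma near_itv (P : R -> Prop) (t : R) : t \in `](-1), 1[ ->
  (forall u, u \in `](-1), 1[ -> P u) -> \forall u \near t, P u.
Proof.
move=> tI hP; have := near_in_itvoo tI.
by apply: filterS => u; exact: hP.
Qed.

Lemma cell_graph_piece m j : cell (graph_piece m j).
Proof.
have gl : graph_like (graph_piece m j).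
  move=> x y z [[_ [_ +]] _] [[_ [_ +]] _].
  by rewrite !extendK !height_extend => -> ->.
split; [exact: semialgebraic_graph_piece| |by left].
move=> g [gD ga] t0 y t0I [[_ [_ +]] _]; rewrite extendK height_extend => yE.
exists (fun t => nth 0 (s (g t)) j); split=> // t tI; split.
  have [y' [[/= sm [jm _]] _]] := gD t tI; rewrite !extendK in sm jm.
  apply: (nth_fibre_analytic (m := m) sZ cZ) => //; last by rewrite -sm.
  - exact: ga.
  - apply: near_itv tI _ => u uI; have [y'' [[/= + _] _]] := gD u uI.
    by rewrite extendK.
have [y' Dy'] := gD t tI; have [[_ [_ +]] _] := Dy'.
by rewrite extendK height_extend => <-.
Qed.

(** An arc through a point of a band is lifted with a constant ratio of the
    distances to the two bounding functions, or with a constant distance to the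
    one that exists, or at constant height if the band is unbounded on both
    sides. *)
Lemma cell_band_piece m j : (j <= m)%N -> cell (band_piece m j).
Proof.
move=> jm.
have DE x y : band_piece m j (extend x y) <-> [/\ size (s x) = m, in_gap (s x) j y &
    forall z, gap m j (extend x z) -> S (extend x z)].
  rewrite /band_piece /gap /setI /= !extendK !height_extend.
  by split=> [[[? ?] ?]|[? ? ?]].
have bl : band_like (band_piece m j).
  split=> [x y z w /DE[sm yg h] /DE[_ zg _] /andP[yw wz]|x y /DE[sm yg h]].
    by apply/DE; split=> //; apply: in_gap_convex yg zg _; rewrite !ltW.
  have [a [b [ab ag bg]]] := in_gap_open yg.
  by exists a, b; split=> //; apply/DE.
split; [exact: semialgebraic_band_piece| |by right].
move=> g [gD ga] t0 y t0I /DE[sm0 [y1 y2] _].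
have gs t : t \in `](-1), 1[ -> size (s (g t)) = m.
  by move=> /gD[y' /DE[]].
have na i t : t \in `](-1), 1[ -> (i < m)%N -> real_analytic_at (fun t => nth 0 (s (g t)) i) t.
  move=> tI im; apply: (nth_fibre_analytic (m := m) sZ cZ) => //; first exact: ga.
  exact: near_itv gs.
pose lo t := nth 0 (s (g t)) j.-1; pose hi t := nth 0 (s (g t)) j.
have loa t : t \in `](-1), 1[ -> (0 < j)%N -> real_analytic_at lo t.
  by move=> tI j0; apply: na => //; rewrite prednK.
have hia t : t \in `](-1), 1[ -> (j < m)%N -> real_analytic_at hi t.
  by move=> tI jm'; apply: na.
have lohi t : t \in `](-1), 1[ -> (0 < j < m)%N -> lo t < hi t.
  move=> tI /andP[j0 jm']; apply: sorted_ltn_nthP; first exact: (sZ _).1.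
    by rewrite gs.
  by rewrite prednK.
suff [f [fy fa fg]] : exists f, [/\ f t0 = y,
    forall t, t \in `](-1), 1[ -> real_analytic_at f t &
    forall t, t \in `](-1), 1[ -> in_gap (s (g t)) j (f t)].
  exists f; split=> // t tI; split; first exact: fa.
  by apply/DE; have [y' /DE[? _ ?]] := gD t tI; split=> //; exact: fg.
rewrite /in_gap; have [j0|j0] := boolP (0 < j)%N; have [jm'|jm'] := boolP (j < m)%N.
- pose c := (y - lo t0) / (hi t0 - lo t0).
  have h0 : 0 < hi t0 - lo t0 by rewrite subr_gt0 lohi // j0.
  have cE : c * (hi t0 - lo t0) = y - lo t0 by rewrite /c divfK ?gt_eqF.
  have l1 : lo t0 < y by exact: y1.
  have l2 : y < hi t0 by apply: y2; rewrite sm0.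
  have c0 : 0 < c by rewrite divr_gt0 // subr_gt0.
  have c1 : c < 1 by rewrite /c ltr_pdivrMr // mul1r ltrD2r.
  exists (fun t => lo t + c * (hi t + -1 * lo t)); split.
  + by rewrite mulN1r cE; ring.
  + move=> t tI; apply: real_analyticD; first exact: loa.
    apply: real_analyticM; first exact: real_analytic_cst.
    apply: real_analyticD; first exact: hia.
    by apply: real_analyticM; [exact: real_analytic_cst|exact: loa].
  + move=> t tI; have lt : lo t < hi t by rewrite lohi // j0.
    by split=> _; rewrite -/(lo t) -/(hi t); nra.
- exists (fun t => lo t + (y - lo t0)); split; first by ring.
  + move=> t tI; apply: real_analyticD; first exact: loa.
    exact: real_analytic_cst.
  + move=> t tI; rewrite gs // (negbTE jm'); split=> // _.
    by have := y1 j0; rewrite -/(lo t0) -/(lo t); lra.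
- exists (fun t => hi t + (y - hi t0)); split; first by ring.
  + move=> t tI; apply: real_analyticD; first exact: hia.
    exact: real_analytic_cst.
  + move=> t tI; split=> // _.
    by have := y2; rewrite sm0 => /(_ jm'); rewrite -/(hi t0) -/(hi t); lra.
- exists (fun=> y); split=> // [t _|t tI]; first exact: real_analytic_cst.
  by rewrite gs // (negbTE jm').
Qed.

Hypothesis hS : forall x y z, y <= z ->
  (forall w, y <= w <= z -> ~ Z (extend x w)) -> S (extend x y) <-> S (extend x z).

(** No breakpoint lies in a gap, so a gap that meets [S] lies in [S]. *)
Lemma pieces_cover v : S v -> exists2 j, (j <= size (s (base v)))%N &
  (j < size (s (base v)))%N /\ graph_piece (size (s (base v))) j v \/
  band_piece (size (s (base v))) j v.
Proof.
rewrite -{1}(extend_base v); set x := base v; set y := height v => Sv.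
have [yl|yl] := boolP (y \in s x).
  have jl : (index y (s x) < size (s x))%N by rewrite index_mem.
  exists (index y (s x)); first exact: ltnW.
  left; split=> //; split; last by rewrite -(extend_base v).
  by split=> //; split=> //; rewrite nth_index.
have [j jl yg] := in_gap_exists yl; exists j => //; right.
split=> // z [_]; rewrite -/x extendK height_extend => zg.
have nZ a b : in_gap (s x) j a -> in_gap (s x) j b ->
    forall w, a <= w <= b -> ~ Z (extend x w).
  move=> ag bg w /(in_gap_convex ag bg) wg /(sZ x).2; apply/negP.
  by apply: in_gap_notin wg; [|exact: (sZ x).1].
have [yz|/ltW zy] := leP y z; first by rewrite -(hS yz (nZ _ _ yg zg)).
by rewrite (hS zy (nZ _ _ zg yg)).
Qed.
End Breakpoints.

Lemma cell_decomposition S : semialgebraic S ->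
  exists (I : eqType) (l : seq I) (C : I -> set 'rV[R]_n.+1),
  (forall i, i \in l -> cell (C i) /\ C i `<=` S) /\
  S `<=` [set v | exists2 i, i \in l & C i v].
Proof.
move=> saS; have [Z [s [N [saZ cZ sZ sN hS]]]] := semialgebraic_breakpoints saS.
pose l := [seq (m, j) | m <- iota 0 N.+1, j <- iota 0 m.+1].
have lP m j : (j <= m <= N)%N -> (m, j) \in l.
  move=> /andP[jm mN]; apply/allpairsPdep; exists m, j.
  by rewrite !mem_iota /= !add0n !ltnS.
exists (nat * nat * bool)%type, [seq (i, b) | i <- l, b <- [:: true; false]],
  (fun i => if i.2 then graph_piece S s i.1.1 i.1.2 else band_piece S s i.1.1 i.1.2).
split=> [[[m j] b] /allpairsP[[[m' j'] b'] /= [+ _ [-> -> ->]]]|v Sv].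
  move=> /allpairsPdep[a [c [_ + [-> ->]]]]; rewrite mem_iota add0n ltnS => /andP[_ jm].
  case: b' => /=.
    by split; [exact: (cell_graph_piece sZ saZ saS cZ)|move=> v [_]].
  split; first exact: (cell_band_piece sZ saZ saS cZ jm).
  by move=> v [gv h]; rewrite -(extend_base v); apply: h; rewrite extend_base.
have [j jm [[_ h]|h]] := pieces_cover sZ hS Sv.
  exists ((size (s (base v)), j), true) => //.
  by apply/allpairsP; exists ((size (s (base v)), j), true); rewrite lP // jm sN.
exists ((size (s (base v)), j), false) => //.
by apply/allpairsP; exists ((size (s (base v)), j), false); rewrite lP // jm sN.
Qed.

(** * The descending chain condition *)

(** In a band, a member [E N] of a chain either fills a fibre or contains no
    interval of it. Over the points of the second kind [E N] decomposes into
    graphs only, over the others all later members of the chain agree. *)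
Lemma arc_noetherian_cell (D : set 'rV[R]_n.+1) :
  (forall B : set 'rV[R]_n, semialgebraic B -> arc_noetherian B) ->
  cell D -> arc_noetherian D.
Proof.
move=> IH cD; have [saD lD [gD|bD]] := cD; first exact: arc_noetherian_graph.
move=> E saE ED sE dE.
have [N NP] := full_fibres_stabilize IH cD saE sE dE.
pose T := E N `\` [set v | full_fibres D (E N) (base v)].
have saT : semialgebraic T.
  apply: semialgebraicD => //; apply: semialgebraic_base.
  exact: semialgebraic_full_fibres.
have [I [l [C [lC lT]]]] := cell_decomposition saT.
have nT : arc_noetherian T.
  apply: arc_noetherian_cover lT => i il; have [cC CT] := lC i il.
  have [saC _ CE] := cC; split=> //; apply: arc_noetherian_graph => //.
  case: CE => // -[convC openC] x y z Cy _; exfalso.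
  have [a [b [ab Ca Cb]]] := openC x y Cy.
  have [ENy nf] := CT _ Cy; apply: nf; rewrite /= extendK; split.
    by exists y; exact: ED ENy.
  apply: (full_fibre_of_interval bD (sE N)) (_ : a < b) _; first by case/andP: ab; lra.
  move=> w wI; have [ENw _] := CT _ (convC x a b w Ca Cb wI).
  by split=> //; exact: ED ENw.
have TD : T `<=` D by move=> v [/ED].
have [||||M MP] := nT (fun k => E (N + k)%N `&` T).
- by move=> k; exact: semialgebraicI.
- by move=> k; exact: subIsetr.
- by move=> k; exact: arc_symmetricS (sE _).
- by move=> k; rewrite addnS; exact: setSI.
exists (N + M)%N => k NMk; have Nk := leq_trans (leq_addr M N) NMk.
apply/seteqP; split; first exact: descending_le.
move=> v Ev; have ENv : E N v by apply: (descending_le dE _ Ev); exact: leq_addr.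
have [|nf] := pselect (full_fibres D (E N) (base v)).
  rewrite -(NP k Nk) => -[_]; rewrite -{2}(extend_base v); apply.
  by rewrite extend_base; exact: ED Ev.
have : (E (N + M)%N `&` T) v by [].
rewrite -(MP (k - N)%N); first by rewrite subnKC // => -[].
by rewrite leq_subRL.
Qed.
End CellDecomposition.

Section Noetherianity.
Local Open Scope classical_set_scope.
Context {R : realType}.

Lemma semialgebraic_arc_noetherian n (S : set 'rV[R]_n) :
  semialgebraic S -> arc_noetherian S.
Proof.
elim: n S => [|n IH] S saS.
  move=> E _ _ _ dE.
  have pt (x y : 'rV[R]_0) : x = y by apply/rowP => -[].
  have [[k Ek]|nE] := pselect (exists k, ~ E k 0%R).
    exists k => j kj; apply/seteqP; split; first exact: descending_le.
    by move=> x; rewrite (pt x 0%R).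
  exists 0%N => j _; apply/seteqP; split; first exact: descending_le.
  by move=> x _; rewrite (pt x 0%R); apply: contrapT => nEj; apply: nE; exists j.
have [I [l [C [lC lS]]]] := cell_decomposition saS.
apply: arc_noetherian_cover lS => i il; have [cC CS] := lC i il.
by split=> //; [case: cC|exact: arc_noetherian_cell].
Qed.
End Noetherianity.

(** * The topology *)
Section ClosedSets.
Local Open Scope classical_set_scope.
Context {R : realType} {n : nat}.
Variable S : set 'rV[R]_n.
Hypothesis saS : semialgebraic S.
Implicit Types F G : set (set_type S).

Definition arc_closed F :=
  semialgebraic [set sval x | x in F] /\ arc_symmetric S [set sval x | x in F].

Lemma image_sval_inj F G : [set sval x | x in F] = [set sval x | x in G] -> F = G.
Proof.
move=> FG; apply/seteqP; split=> x Fx.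
  by have : [set sval x | x in G] (sval x) by [rewrite -FG; exists x];
    move=> [y Gy /val_inj <-].
by have : [set sval x | x in F] (sval x) by [rewrite FG; exists x];
  move=> [y Gy /val_inj <-].
Qed.

Lemma image_sval_sub F : [set sval x | x in F] `<=` S.
Proof. by move=> _ [x _ <-]; exact: set_valP. Qed.

Lemma arc_closedT : arc_closed setT.
Proof.
suff e : [set sval x | x in (setT : set (set_type S))] = S.
  by rewrite /arc_closed e; split=> // g [gS _] _ t tI; exact: gS.
apply/seteqP; split; first exact: image_sval_sub.
by move=> x Sx; exists (SigSub (mem_set Sx)).
Qed.

Lemma arc_closed0 : arc_closed set0.
Proof.
rewrite /arc_closed image_set0; split; first exact: semialgebraic0.
move=> g _ /(_ (- 2^-1)%R) []; rewrite in_itv /=; apply/andP; split; lra.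
Qed.

Lemma arc_closedU F G : arc_closed F -> arc_closed G -> arc_closed (F `|` G).
Proof.
move=> [saF sF] [saG sG]; rewrite /arc_closed image_setU.
by split; [exact: semialgebraicU|exact: arc_symmetricU].
Qed.

Lemma image_svalI F G : [set sval x | x in F `&` G] =
  [set sval x | x in F] `&` [set sval x | x in G].
Proof.
apply/seteqP; split; first by move=> _ [x [Fx Gx] <-]; split; exists x.
by move=> _ [[x Fx <-] [y Gy /val_inj yx]]; exists x => //; split=> //; rewrite -yx.
Qed.

Lemma arc_closedI F G : arc_closed F -> arc_closed G -> arc_closed (F `&` G).
Proof.
move=> [saF sF] [saG sG]; rewrite /arc_closed image_svalI.
split; first exact: semialgebraicI.
by move=> g gS gE t tI; split; [apply: sF tI|apply: sG tI] => // u /gE[].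
Qed.

Lemma arc_closed_noetherian (F : nat -> set (set_type S)) :
  (forall k, arc_closed (F k)) -> (forall k, F k.+1 `<=` F k) ->
  exists N, forall k, (N <= k)%N -> F k = F N.
Proof.
move=> cF dF.
have [||||N NP] := semialgebraic_arc_noetherian saS
  (E := fun k => [set sval x | x in F k]).
- by move=> k; exact: (cF k).1.
- by move=> k; exact: image_sval_sub.
- by move=> k; exact: (cF k).2.
- by move=> k; exact: image_subset.
by exists N => k Nk; apply: image_sval_inj; exact: NP.
Qed.

(** Otherwise one could intersect finitely many members at a time and obtain a
    strictly decreasing sequence. *)
Lemma arc_closed_bigcap (I : Type) (F : I -> set (set_type S)) :
  (forall i, arc_closed (F i)) -> arc_closed (\bigcap_i F i).
Proof.
move=> cF; apply: contrapT => nc.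
have next (G : set (set_type S)) : exists i, arc_closed G -> \bigcap_i F i `<=` G ->
    ~ (G `<=` F i).
  have [[cG FG]|h] := pselect (arc_closed G /\ \bigcap_i F i `<=` G).
    apply: contrapT => /forallNP/= nex; apply: nc.
    suff -> : \bigcap_i F i = G by [].
    apply/seteqP; split=> // x Gx i _; apply: contrapT => nFx; apply: (nex i) => _ _.
    by move=> /(_ x Gx).
  have [[i]|nI] := pselect (exists i : I, True); first by exists i => cG FG; case: h.
  exfalso; apply: nc; suff -> : \bigcap_i F i = setT by exact: arc_closedT.
  by apply/seteqP; split=> // x _ i; case: nI; exists i.
have [f fP] := choice next.
pose E k := iter k (fun G => G `&` F (f G)) setT.
have cE k : arc_closed (E k).
  by elim: k => [|k IH]; [exact: arc_closedT|exact: arc_closedI].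
have sE k : \bigcap_i F i `<=` E k.
  by elim: k => [|k IH] // x Fx; split; [exact: IH|exact: Fx].
have [|N NP] := arc_closed_noetherian cE; first by move=> k x [].
apply: (fP (E N) (cE N) (sE N)) => x Ex.
have : E N.+1 x by rewrite (NP N.+1 (leqnSn N)).
by case.
Qed.

Definition arc_open F := arc_closed (~` F).

Lemma arc_openT : arc_open setT.
Proof. by rewrite /arc_open setCT; exact: arc_closed0. Qed.

Lemma arc_openI : setI_closed arc_open.
Proof. by move=> F G oF oG; rewrite /arc_open setCI; exact: arc_closedU. Qed.

Lemma arc_open_bigU (I : Type) (F : I -> set (set_type S)) :
  (forall i, arc_open (F i)) -> arc_open (\bigcup_i F i).
Proof. by move=> oF; rewrite /arc_open setC_bigcup; exact: arc_closed_bigcap. Qed.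

(** A copy of [S] on which the topology is declared; the argument lets the axioms
    of a topology, which rest on semialgebraicity, be found from the type. *)
Definition arc_space (_ : semialgebraic S) : Type := set_type S.
HB.instance Definition _ := Choice.on (arc_space saS).
HB.instance Definition _ := isOpenTopological.Build (arc_space saS)
  arc_openT arc_openI arc_open_bigU.
End ClosedSets.

Local Open Scope classical_set_scope.

Theorem theorem3p5 (R : realType) (n : nat) (S : set 'rV[R]_n)
    (hS : semialgebraic S) :
  exists tau : Topological (set_type S),
    let T : topologicalType := Topological.Pack tau in
    noetherian_space T /\
    forall F : set T,
      closed F <->
      semialgebraic [set sval x | x in F] /\
      arc_symmetric S [set sval x | x in F].
Proof.
exists (Topological.class (arc_space hS : topologicalType)) => /=.
have closedE (F : set (arc_space hS)) : closed F <-> arc_closed F.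
  by rewrite -openC -[X in _ <-> arc_closed X]setCK.
split=> [F cF dF|F]; last exact: (closedE F).
by apply: (arc_closed_noetherian hS) => // k; apply/closedE; exact: cF.
Qed.
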